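(* Let $X_1,\ldots,X_n$ be i.i.d. $N_p(0,\Sigma_0)$, where $p=p_n$ and $s_0=s_{0,n}$ may depend on $n$. For a positive integer $s_0$ and a real number $\tau_0>1$, let $$\mathcal{U}(s_0,\tau_0)=\{\Sigma\in\mathcal{C}_p: |s(\Sigma)|\le s_0,\ \tau_0^{-1}\le\lambda_{\min}(\Sigma)\le\lambda_{\max}(\Sigma)\le\tau_0\}.$$ If $s_0^2(\log p)^3=O(p^2n)$ and $s_0^2=O(p^{3-\epsilon})$ for some small constant $\epsilon>0$, then $$\inf_{\hat\Sigma}\sup_{\Sigma_0\in\mathcal{U}(s_0,\tau_0)}\mathbb{E}_0\|\hat\Sigma-\Sigma_0\|_F^2\ \gtrsim\ \frac{s_0\log p}{n}\,I(s_0>3p)+\frac{p}{n},$$ where the infimum is over all estimators $\hat\Sigma$ (measurable functions of $X_1,\ldots,X_n$) and $\mathbb{E}_0$ is expectation under $\Sigma_0$.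
   Context: $\mathcal{C}_p$ is the set of $p\times p$ positive definite matrices; $|s(\Sigma)|$ is the number of nonzero off-diagonal entries of $\Sigma$; $\|\cdot\|_F$ is the Frobenius norm. $a_n=O(b_n)$ means $a_n/b_n$ is bounded; $a_n\gtrsim b_n$ means $b_n\le C a_n$ for a constant $C>0$ not depending on $n$. Asymptotics are as $n\to\infty$. *)

(* Defs.v *)
From HB Require Import structures.
From mathcomp Require Import all_boot all_order all_algebra.
From mathcomp Require Import all_classical all_reals all_analysis.
Set Implicit Arguments. Unset Strict Implicit. Unset Printing Implicit Defensive.
Import Order.TTheory GRing.Theory Num.Theory.
Import numFieldNormedType.Exports.
Local Open Scope classical_set_scope.
Local Open Scope ring_scope.

Section Defs.
Variable R : realType.

Definition posdef p (S : 'M[R]_p) : Prop :=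
  S^T = S /\ forall x : 'rV[R]_p, x != 0 -> 0 < (x *m S *m x^T) ord0 ord0.

Definition offdiag_nnz p (S : 'M[R]_p) : nat :=
  #|[set ij : 'I_p * 'I_p | (ij.1 != ij.2) && (S ij.1 ij.2 != 0)]|.

Definition frob2 p (A : 'M[R]_p) : R := \sum_i \sum_j (A i j) ^+ 2.

(* U(s0, tau0); the condition tau0^-1 <= lambda_min <= lambda_max <= tau0
   is written as: every (real) eigenvalue of S lies in [tau0^-1, tau0]. *)
Definition Uclass p (s0 : nat) (tau0 : R) : set 'M[R]_p :=
  [set S | posdef S /\ (offdiag_nnz S <= s0)%N /\
           forall a : R, eigenvalue S a -> tau0^-1 <= a <= tau0].

Definition rowv p (x : p.-tuple R) : 'rV[R]_p := \row_i tnth x i.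

Definition gauss_dens p (S : 'M[R]_p) (x : p.-tuple R) : R :=
  expR (- ((rowv x *m invmx S *m (rowv x)^T) ord0 ord0) / 2)
  / Num.sqrt ((2 * pi) ^+ p * \det S).

(* iterated Lebesgue integral over R^k (nonnegative integrands) *)
Fixpoint iint_Rk (k : nat) : (k.-tuple R -> \bar R) -> \bar R :=
  match k return (k.-tuple R -> \bar R) -> \bar R with
  | 0 => fun f => f [tuple]
  | k'.+1 => fun f =>
      (\int[@lebesgue_measure R]_t iint_Rk (fun x => f (cons_tuple t x)))%E
  end.

Fixpoint iint_sample (p n : nat) :
    (n.-tuple (p.-tuple R) -> \bar R) -> \bar R :=
  match n return (n.-tuple (p.-tuple R) -> \bar R) -> \bar R with
  | 0 => fun f => f [tuple]
  | n'.+1 => fun f =>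
      iint_Rk (fun x => iint_sample (fun X => f (cons_tuple x X)))
  end.

Definition risk p n (Sh : n.-tuple (p.-tuple R) -> 'M[R]_p) (S : 'M[R]_p)
  : \bar R :=
  iint_sample (fun X =>
    (frob2 (Sh X - S) * \prod_(i < n) gauss_dens S (tnth X i))%:E).

Definition estimator p n (Sh : n.-tuple (p.-tuple R) -> 'M[R]_p) : Prop :=
  forall i j : 'I_p, measurable_fun setT (fun X => Sh X i j).

Definition minimax_risk p n (s0 : nat) (tau0 : R) : \bar R :=
  ereal_inf [set ereal_sup [set risk Sh S | S in @Uclass p s0 tau0]
            | Sh in [set Sh | @estimator p n Sh]].

End Defs.

(* Main.v *)
Require Import Defs.
From HB Require Import structures.
From mathcomp Require Import all_boot all_order all_algebra.
From mathcomp Require Import all_classical all_reals all_analysis.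
From mathcomp Require Import fingroup perm measurable_realfun ring lra zify.
Import Order.TTheory GRing.Theory Num.Theory.
Import numFieldNormedType.Exports.
Local Open Scope classical_set_scope.
Local Open Scope ring_scope.
Set Implicit Arguments. Unset Strict Implicit. Unset Printing Implicit Defensive.

(** A finite family [1 + A_j] of covariance matrices is compared with the
    identity.  If [f_j] and [f_0] are the joint densities of the sample, the
    chi-square integral of [f_j ^ 2 / f_0] equals
    [det (1 - A_j ^ 2) ^ (- n / 2)], which Hadamard's inequality bounds by
    [exp (n * frob2 A_j)].  An estimator is within squared distance [r] of few
    members of the family at every sample point, so an AM-GM splitting of each [f_j]
    against [f_0] bounds the average risk below by [r / 2] as soon as the number
    of members in such a ball is small compared to the size of the family
    divided by the chi-square bound.  The size of balls is controlled by an
    exponential moment of the number of agreements between two parameters.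

    The term [p / n] comes from diagonal matrices with entries of order
    [n ^ (-1/2)].  The term [s0 * ln p / n] comes from [a] times the adjacency
    matrix of a bipartite graph, [a ^ 2] being of order [ln p / n]: each side is
    cut into [k ~ s0 / p] blocks of size [q ~ p / k], joined pairwise by
    arbitrary permutations.  All degrees are at most [k], which controls the
    spectrum through row sums, while the [q!] choices for each of the [k ^ 2]
    permutations supply the factor [ln p]. *)

(** * Iterated integrals *)

Section integrator.
Context {R : realType}.
Local Open Scope ereal_scope.

(* Measurability in a parameter is what makes the notion stable under
   iteration, without constructing product measures on tuples. *)
Record integrator d (T : measurableType d) (I : (T -> \bar R) -> \bar R) : Prop :=
  Integrator {
  integrator_param : forall d' (S : measurableType d') (F : S * T -> \bar R),
    measurable_fun setT F -> (forall z, 0 <= F z) ->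
    measurable_fun setT (fun s => I (fun t => F (s, t)));
  integrator_ge0 : forall f, (forall t, 0 <= f t) -> 0 <= I f;
  integrator_le : forall f g, measurable_fun setT f -> measurable_fun setT g ->
    (forall t, 0 <= f t) -> (forall t, f t <= g t) -> I f <= I g;
  integratorD : forall f g, measurable_fun setT f -> measurable_fun setT g ->
    (forall t, 0 <= f t) -> (forall t, 0 <= g t) ->
    I (fun t => f t + g t) = I f + I g;
  integratorZ : forall f (k : \bar R), measurable_fun setT f ->
    (forall t, 0 <= f t) -> 0 <= k -> I (fun t => k * f t) = k * I f }.

(** Both [iint_Rk] and [iint_sample] are instances, so one induction covers the coordinates of a
    vector and the vectors of a sample. *)
Fixpoint tuple_iter T (I : (T -> \bar R) -> \bar R) n :
    (n.-tuple T -> \bar R) -> \bar R :=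
  match n return (n.-tuple T -> \bar R) -> \bar R with
  | 0 => fun f => f [tuple]
  | n'.+1 => fun f => I (fun t => tuple_iter I (fun x => f (cons_tuple t x)))
  end.

Lemma measurable_cons_tuple d (T : measurableType d) n :
  measurable_fun setT (fun z : T * n.-tuple T => cons_tuple z.1 z.2).
Proof.
by apply: (@measurable_cons _ _ _ _ (@fst T (n.-tuple T)) n (@snd T (n.-tuple T))).
Qed.

Lemma measurable_cons_tuple_l d (T : measurableType d) n (f : n.+1.-tuple T -> \bar R) t :
  measurable_fun setT f -> measurable_fun setT (fun x => f (cons_tuple t x)).
Proof.
move=> mf.
apply: (measurableT_comp (g := fun x : n.-tuple T => cons_tuple t x) mf).
apply: (measurableT_comp (g := fun x : n.-tuple T => (t, x)) (@measurable_cons_tuple _ T n)).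
exact: pair1_measurable.
Qed.

Lemma integrator_tuple_iter d (T : measurableType d) I n :
  integrator I -> @integrator _ (n.-tuple T) (@tuple_iter T I n).
Proof.
move=> HI; elim: n => [|n IH].
  split => //=.
  - move=> d' S F mF _.
    apply: (measurableT_comp (g := fun s : S => (s, [tuple] : 0.-tuple T)) mF).
    exact: pair2_measurable.
have mI (f : n.+1.-tuple T -> \bar R) : measurable_fun setT f ->
    (forall t, 0 <= f t) ->
    measurable_fun setT (fun t => tuple_iter I (fun x => f (cons_tuple t x))).
  move=> mf f0.
  apply: (integrator_param IH (F := fun z => f (cons_tuple z.1 z.2))) => //.
  by apply: measurableT_comp => //; exact: measurable_cons_tuple.
split => /=.
- move=> d' S F mF F0.
  (* The outer parameter and the first coordinate together act as the parameter of the inner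
     integral. *)
  apply: (integrator_param HI
    (F := fun z => tuple_iter I (fun x => F (z.1, cons_tuple z.2 x)))) => [|z].
    apply: (integrator_param IH
      (F := fun z => F (z.1.1, cons_tuple z.1.2 z.2))) => //.
    apply: (measurableT_comp (g := fun z : (S * T) * n.-tuple T =>
      (z.1.1, cons_tuple z.1.2 z.2)) mF).
    apply/measurable_fun_pairP; split => /=.
      by apply: (measurableT_comp (g := fst)) => //; exact: measurable_fst.
    apply: (measurableT_comp (g := fun z : (S * T) * n.-tuple T =>
      (z.1.2, z.2)) (@measurable_cons_tuple _ T n)).
    apply/measurable_fun_pairP; split => /=; last exact: measurable_snd.
    by apply: (measurableT_comp (g := fst)); [exact: measurable_snd|exact: measurable_fst].
  by apply: (integrator_ge0 IH) => x; exact: F0.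
- by move=> f f0; apply: (integrator_ge0 HI) => t; apply: (integrator_ge0 IH).
- move=> f g mf mg f0 fg; apply: (integrator_le HI).
  + exact: mI.
  + by apply: mI => // t; apply: le_trans (fg t).
  + by move=> t; apply: (integrator_ge0 IH).
  + by move=> t; apply: (integrator_le IH) => //; apply: measurable_cons_tuple_l.
- move=> f g mf mg f0 g0.
  rewrite -(integratorD HI); [|exact: mI|exact: mI| |].
  + congr I; apply/funext => t.
    by rewrite (integratorD IH) //; apply: measurable_cons_tuple_l.
  + by move=> t; apply: (integrator_ge0 IH).
  + by move=> t; apply: (integrator_ge0 IH).
- move=> f k mf f0 k0.
  rewrite -(integratorZ HI) //; [|exact: mI|].
  + congr I; apply/funext => t.
    by rewrite (integratorZ IH) //; apply: measurable_cons_tuple_l.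
  + by move=> t; apply: (integrator_ge0 IH).
Qed.

Lemma integrator_sum d (T : measurableType d) I (J : Type) (s : seq J)
    (f : J -> T -> \bar R) : integrator I ->
  (forall j, measurable_fun setT (f j)) -> (forall j t, 0 <= f j t) ->
  I (fun t => \sum_(j <- s) f j t) = \sum_(j <- s) I (f j).
Proof.
move=> HI mf f0; elim: s => [|j s IHs].
  rewrite big_nil; under eq_fun do rewrite big_nil.
  rewrite -[RHS](mul0e (I (fun=> 0))) -(integratorZ HI) //.
  by congr I; apply/funext => t; rewrite mul0e.
rewrite big_cons -IHs; under eq_fun do rewrite big_cons.
rewrite (integratorD HI) //; first exact: emeasurable_sum.
by move=> t; exact: sume_ge0.
Qed.

Lemma integrator_lebesgue :
  @integrator _ R (fun f => \int[@lebesgue_measure R]_t f t).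
Proof.
split.
- move=> d' S F mF F0.
  exact: (measurable_fun_fubini_tonelli_F (m2 := @lebesgue_measure R) F mF F0).
- by move=> f f0; apply: integral_ge0.
- move=> f g mf mg f0 fg; exact: ge0_le_integral.
- move=> f g mf mg f0 g0; exact: ge0_integralD.
- move=> f k mf f0 k0; exact: ge0_integralZl.
Qed.

Lemma iint_RkE k :
  @iint_Rk R k = @tuple_iter R (fun f => \int[@lebesgue_measure R]_t f t) k.
Proof.
elim: k => //= k IH; apply/funext => f.
by apply: eq_integral => t _; rewrite IH.
Qed.

Lemma iint_sampleE p n :
  @iint_sample R p n = @tuple_iter (p.-tuple R) (@iint_Rk R p) n.
Proof.
elim: n => //= n IH; apply/funext => f; congr iint_Rk.
by apply/funext => t; rewrite IH.
Qed.

Lemma integrator_iint_Rk k : integrator (@iint_Rk R k).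
Proof.
rewrite iint_RkE; apply: integrator_tuple_iter; exact: integrator_lebesgue.
Qed.

Lemma integrator_iint_sample p n : integrator (@iint_sample R p n).
Proof.
rewrite iint_sampleE; apply: integrator_tuple_iter; exact: integrator_iint_Rk.
Qed.

(** Homogeneity pulls the factors out one coordinate at a time. This reduces integrals over an
    i.i.d. sample to a single observation. *)
Lemma tuple_iter_prod d (T : measurableType d) I n (g : T -> R) (c : R) :
  integrator I -> measurable_fun setT g -> (forall t, (0 <= g t)%R) ->
  I (fun t => (g t)%:E) = c%:E ->
  @tuple_iter T I n (fun X => (\prod_(i < n) g (tnth X i))%R%:E) = (c ^+ n)%R%:E.
Proof.
move=> HI mg g0 Ig.
have c0 : (0 <= c)%R.
  by rewrite -lee_fin -Ig; apply: (integrator_ge0 HI) => t; rewrite lee_fin.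
elim: n => [|n IH] /=; first by rewrite big_ord0 expr0.
have mgE : measurable_fun setT (EFin \o g) by apply/measurable_EFinP.
have mprod : measurable_fun setT
    (fun X : n.-tuple T => (\prod_(i < n) g (tnth X i))%R%:E).
  apply/measurable_EFinP; apply: measurable_prod => i _.
  by apply: measurableT_comp => //; exact: measurable_tnth.
transitivity (I (fun t => (c ^+ n)%R%:E * (g t)%:E)).
  congr I; apply/funext => t; rewrite muleC -IH.
  rewrite -(integratorZ (integrator_tuple_iter n HI)) //.
  - congr tuple_iter; apply/funext => X; rewrite -EFinM big_ord_recl /=.
    rewrite tnth0; congr (_ * _)%:E.
    by apply: eq_bigr => i _; rewrite tnthS.
  - by move=> X; rewrite lee_fin prodr_ge0.
  - by rewrite lee_fin.
rewrite (integratorZ HI) //; first by rewrite Ig -EFinM exprSr.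
by rewrite lee_fin exprn_ge0.
Qed.

End integrator.

(** * Quadratic forms and determinants *)

Section quadratic_forms.
Context {R : realType}.

Definition qform n (S : 'M[R]_n) (x : 'rV[R]_n) : R := (x *m S *m x^T) ord0 ord0.

Lemma qformE n (S : 'M[R]_n) x :
  qform S x = \sum_i \sum_j x ord0 i * S i j * x ord0 j.
Proof.
rewrite /qform mxE exchange_big /=; apply: eq_bigr => j _.
by rewrite !mxE mulr_suml.
Qed.

Lemma qform1 n (x : 'rV[R]_n) : qform 1%:M x = \sum_i x ord0 i ^+ 2.
Proof. by rewrite /qform mulmx1 mxE; apply: eq_bigr => i _; rewrite mxE. Qed.

Lemma qform1_ge0 n (x : 'rV[R]_n) : 0 <= qform 1%:M x.
Proof. by rewrite qform1 sumr_ge0 // => i _; rewrite sqr_ge0. Qed.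

Lemma qform1_gt0 n (x : 'rV[R]_n) : x != 0 -> 0 < qform 1%:M x.
Proof.
move=> x0; rewrite lt_def qform1_ge0 andbT; apply: contra x0 => /eqP.
rewrite qform1 => /eqP; rewrite psumr_eq0 => [/allP H|i _]; last exact: sqr_ge0.
apply/eqP/rowP => i; rewrite mxE; apply/eqP.
by have := H i (mem_index_enum _); rewrite /= sqrf_eq0.
Qed.

Lemma qform_ge0 n (S : 'M[R]_n) x : posdef S -> 0 <= qform S x.
Proof.
case=> _ H; have [->|/H/ltW//] := eqVneq x 0.
by rewrite /qform !mul0mx mxE.
Qed.

Lemma qformD n (S T : 'M[R]_n) x : qform (S + T) x = qform S x + qform T x.
Proof. by rewrite /qform mulmxDr mulmxDl mxE. Qed.

Lemma qformB n (S T : 'M[R]_n) x : qform (S - T) x = qform S x - qform T x.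
Proof. by rewrite /qform mulmxBr mulmxBl !mxE. Qed.

Lemma qformMn n (S : 'M[R]_n) m x : qform (S *+ m) x = qform S x *+ m.
Proof. by elim: m => [|m IH]; rewrite ?mulrS ?qformD ?IH // /qform mulmx0 mul0mx mxE. Qed.

Lemma qform_congr n (S P : 'M[R]_n) x : qform S (x *m P) = qform (P *m S *m P^T) x.
Proof. by rewrite /qform trmx_mul !mulmxA. Qed.

End quadratic_forms.

(** * Schur complements with a scalar corner *)

Section schur.
Context {R : realType} (n : nat) (M : 'M[R]_(1 + n)).
Hypothesis symM : M^T = M.

Local Notation c := (ulsubmx M).
Local Notation b := (ursubmx M).
Local Notation D := (drsubmx M).
Let h : 'rV[R]_n := b *m invmx D.

Definition schur : R := (c - h *m b^T) ord0 ord0.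

Lemma tr_ursubmx_sym : (ursubmx M)^T = dlsubmx M.
Proof. by rewrite trmx_ursub symM. Qed.

Lemma tr_drsubmx_sym : (drsubmx M)^T = drsubmx M.
Proof. by rewrite trmx_drsub symM. Qed.

Hypothesis unitD : D \in unitmx.

(** Block elimination: [M] is congruent to the block diagonal of [schur] and [D] through a
    triangular matrix with unit diagonal. *)
Lemma schur_det : \det M = schur * \det D.
Proof.
have hD : h *m D = b by rewrite /h mulmxKV.
have Dh : D *m h^T = b^T by rewrite -{1}tr_drsubmx_sym -trmx_mul hD.
have E : M = block_mx 1%:M h 0 1%:M *m block_mx schur%:M 0 0 D
              *m block_mx 1%:M 0 h^T 1%:M.
  rewrite !mulmx_block !mul1mx !mul0mx !mulmx0 !mulmx1 !addr0 !add0r hD Dh.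
  rewrite -[LHS]submxK tr_ursubmx_sym; congr block_mx.
  by rewrite /schur -mx11_scalar -{2}hD -mulmxA Dh subrK.
by rewrite [in LHS]E !det_mulmx !det_ublock det_lblock !det1 !mul1r mulr1 det_scalar1.
Qed.

(** Completing the square in [y]. This identity drives every induction on the dimension below,
    including the Gaussian integral. *)
Lemma schur_qform (t : R) (y : 'rV[R]_n) :
  qform M (row_mx t%:M y) = schur * t ^+ 2 + qform D (y + t *: h).
Proof.
have hD : h *m D = b by rewrite /h mulmxKV.
have Dh : D *m h^T = b^T by rewrite -{1}tr_drsubmx_sym -trmx_mul hD.
rewrite /qform -{1}[M]submxK -tr_ursubmx_sym mul_row_block tr_row_mx mul_row_col.
rewrite linearD /= linearZ /= !mulmxDl !mulmxDr -!scalemxAl -!scalemxAr hD.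
rewrite -[y *m D *m h^T]mulmxA Dh tr_scalar_mx !mul_mx_scalar !mul_scalar_mx.
have -> : b *m h^T = h *m b^T.
  by rewrite -{1}hD -mulmxA Dh.
rewrite /schur -!scalemxAl !mxE; ring.
Qed.

(** The choice [t = 1], [y = - h] cancels the square, so a lower bound on the form of [M] passes to
    [schur]. *)
Lemma schurE : schur = qform M (row_mx 1%:M (- h)).
Proof.
rewrite schur_qform scale1r addNr /qform !mul0mx mxE; ring.
Qed.

Lemma schur_ul : M (lshift n ord0) (lshift n ord0) = schur + qform D h.
Proof.
have := schur_qform 1 0; rewrite scale1r add0r expr1n mulr1 => <-.
rewrite /qform -{2}[M]submxK mul_row_block tr_row_mx mul_row_col.
by rewrite !trmx0 !mulmx0 addr0 mul0mx addr0 mul1mx trmx1 mulmx1 !mxE.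
Qed.

End schur.

Section posdef_det.
Context {R : realType}.

Lemma qform_row_mx0 n (M : 'M[R]_(1 + n)) (y : 'rV[R]_n) :
  qform M (row_mx 0 y) = qform (drsubmx M) y.
Proof.
rewrite /qform -{1}[M]submxK mul_row_block tr_row_mx mul_row_col.
by rewrite trmx0 !mul0mx !mulmx0 !add0r.
Qed.

Lemma posdef_drsubmx n (M : 'M[R]_(1 + n)) : posdef M -> posdef (drsubmx M).
Proof.
case=> sM pM; split=> [|y y0]; first exact: tr_drsubmx_sym.
rewrite -/(qform _ _) -qform_row_mx0; apply: pM.
by apply: contra y0 => /eqP/(congr1 rsubmx); rewrite row_mxKr linear0 => ->.
Qed.

Lemma row_mx1_neq0 n (y : 'rV[R]_n) : row_mx (1%:M : 'M[R]_1) y != 0.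
Proof.
apply/eqP => /(congr1 lsubmx); rewrite row_mxKl linear0 => /matrixP/(_ ord0 ord0).
by rewrite !mxE /= => /eqP; rewrite oner_eq0.
Qed.

Lemma schur_gt0 n (M : 'M[R]_(1 + n)) : posdef M -> drsubmx M \in unitmx ->
  0 < schur M.
Proof. by case=> sM pM uD; rewrite schurE //; apply: pM; exact: row_mx1_neq0. Qed.

Lemma posdef_det_gt0 n (M : 'M[R]_n) : posdef M -> 0 < \det M.
Proof.
elim: n M => [|n IH] M pM; first by rewrite det_mx00.
have pD := @posdef_drsubmx n M pM; have dD := IH _ pD.
have uD : drsubmx (M : 'M[R]_(1 + n)) \in unitmx by rewrite unitmxE unitfE gt_eqF.
by rewrite (schur_det (n := n) (proj1 pM) uD) mulr_gt0 // schur_gt0.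
Qed.

Lemma posdef_unitmx n (M : 'M[R]_n) : posdef M -> M \in unitmx.
Proof. by move=> /posdef_det_gt0 d; rewrite unitmxE unitfE gt_eqF. Qed.

(** Hadamard's inequality. By [schur_ul] the Schur complement is at most the corner entry, and the
    determinant is a product of successive Schur complements. *)
Lemma posdef_det_le n (M : 'M[R]_n) : posdef M -> \det M <= \prod_i M i i.
Proof.
elim: n M => [|n IH] M pM; first by rewrite det_mx00 big_ord0.
have pD := @posdef_drsubmx n M pM; have uD := posdef_unitmx pD.
rewrite (schur_det (n := n) (proj1 pM) uD) big_ord_recl.
apply: ler_pM.
- exact/ltW/schur_gt0.
- exact/ltW/posdef_det_gt0.
- have := schur_ul (n := n) (proj1 pM) uD; rewrite (_ : lshift n ord0 = ord0); last exact/val_inj.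
  by move=> ->; rewrite lerDl; exact: qform_ge0.
- apply: le_trans (IH _ pD) _; rewrite le_eqVlt; apply/orP; left; apply/eqP.
  apply: eq_bigr => i _; rewrite !mxE; congr (M _ _); exact/val_inj.
Qed.

(** Each Schur complement is the value of the form at a vector with first coordinate 1, hence at
    least 1. *)
Lemma det_ge1 n (M : 'M[R]_n) : M^T = M ->
  (forall x, qform 1%:M x <= qform M x) -> 1 <= \det M.
Proof.
elim: n M => [|n IH] M sM H; first by rewrite det_mx00.
have pM : posdef M by split=> // x /qform1_gt0 x0; exact: lt_le_trans (H x).
have pD := @posdef_drsubmx n M pM; have uD := posdef_unitmx pD.
rewrite (schur_det (n := n) sM uD).
have E t y : qform (1%:M : 'M[R]_(1 + n)) (row_mx t y) = t ord0 ord0 ^+ 2 + qform 1%:M y.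
  by rewrite !qform1 big_split_ord big_ord1 /= row_mxEl; congr (_ + _);
    apply: eq_bigr => i _; rewrite row_mxEr.
have s1 : 1 <= schur (M : 'M[R]_(1 + n)).
  rewrite schurE //; apply: le_trans (H _); rewrite E mxE eqxx /= expr1n lerDl.
  exact: qform1_ge0.
apply: (@le_trans _ _ (1 * 1)); first by rewrite mulr1.
apply: ler_pM => //; apply: IH => [|y]; first exact: (proj1 pD).
apply: le_trans (_ : qform M (row_mx (0 : 'M[R]_1) y) <= _).
  by apply: le_trans (H _); rewrite E mxE expr0n add0r.
by rewrite qform_row_mx0.
Qed.

End posdef_det.

(** * Gaussian integrals *)

Section gaussian.
Context {R : realType}.

Lemma integral_gauss_1d (s m : R) : 0 < s ->
  (\int[@lebesgue_measure R]_t (expR (- (s * (t - m) ^+ 2) / 2))%:E)%E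
  = (Num.sqrt (2 * pi) / Num.sqrt s)%:E.
Proof.
move=> s0; pose sg := (Num.sqrt s)^-1.
have sq0 : 0 < Num.sqrt s by rewrite sqrtr_gt0.
have sg0 : sg != 0 by rewrite invr_eq0 gt_eqF.
have E t : expR (- (s * (t - m) ^+ 2) / 2) = normal_fun m sg t.
  rewrite /normal_fun; congr expR.
  rewrite /sg exprVn sqr_sqrtr ?ltW //; field.
  by rewrite gt_eqF.
under eq_integral do rewrite E.
set X := (\int[_]_x _)%E.
have := @integral_normal_pdf R m sg; rewrite /normal_pdf (negbTE sg0).
under eq_integral do rewrite EFinM.
rewrite ge0_integralZl //; last first.
- by rewrite lee_fin normal_peak_ge0.
- by move=> x _; rewrite lee_fin normal_fun_ge0.
- by apply/measurable_EFinP; exact: measurable_normal_fun.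
have p0 := @normal_peak_gt0 R sg sg0.
(* The integral is a priori an extended real; [+oo] is excluded because its product with the
   positive peak equals 1. *)
rewrite -/X; have X0 : (0 <= X)%E by apply: integral_ge0 => x _; rewrite lee_fin normal_fun_ge0.
case: X X0 => [x| |] X0 H; last by [].
  have -> : x = (normal_peak sg)^-1.
    move: H => /eqP; rewrite -EFinM eqe => /eqP H.
    by rewrite -[RHS]mulr1 -H mulKf // gt_eqF.
  congr EFin; rewrite /normal_peak invrK.
  have -> : sg ^+ 2 * pi *+ 2 = sg ^+ 2 * (2 * pi) by ring.
  by rewrite sqrtrM ?sqr_ge0 // sqrtr_sqr gtr0_norm ?invr_gt0 // mulrC.
by move: H; rewrite gt0_muley // lte_fin.
Qed.

Lemma rowv_cons_sub p (t : R) (x : p.-tuple R) (m : 'rV[R]_(1 + p)) :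
  (rowv (cons_tuple t x) : 'rV[R]_(1 + p)) - m =
  row_mx (t - m ord0 ord0)%:M (rowv x - rsubmx m).
Proof.
apply/rowP => i; rewrite mxE [in LHS]mxE; case: (split_ordP i) => j ->.
  rewrite row_mxEl [j]ord1 !mxE eqxx mulr1n.
  by rewrite (_ : lshift p ord0 = ord0) ?tnth0 //; exact/val_inj.
by rewrite row_mxEr !mxE (_ : rshift 1 j = lift ord0 j) ?tnthS //; exact/val_inj.
Qed.

Lemma measurable_qform_rowv p (S : 'M[R]_p) m :
  measurable_fun setT (fun x : p.-tuple R => qform S (rowv x - m)).
Proof.
have -> : (fun x : p.-tuple R => qform S (rowv x - m)) =
    (fun x => \sum_i \sum_j (tnth x i - m ord0 i) * S i j * (tnth x j - m ord0 j)).
  by apply/funext => x; rewrite qformE; do 2!apply: eq_bigr => ? _; rewrite !mxE.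
apply: measurable_sum => i; apply: measurable_sum => j.
by do 2?[apply: measurable_funM => //]; apply: measurable_funB => //;
  exact: measurable_tnth.
Qed.

Lemma measurable_gauss_fun p (S : 'M[R]_p) m :
  measurable_fun setT (fun x : p.-tuple R => expR (- qform S (rowv x - m) / 2)).
Proof.
apply: measurableT_comp => //; apply: measurable_funM => //.
by apply: measurableT_comp => //; exact: measurable_qform_rowv.
Qed.

(** The centre [m] is there for the induction: once the square is completed, the remaining
    coordinates are centred at a point that moves with the first coordinate [t]. *)
Lemma iint_gauss p (S : 'M[R]_p) m : posdef S ->
  iint_Rk (fun x => (expR (- qform S (rowv x - m) / 2))%:E)
  = (Num.sqrt (2 * pi) ^+ p / Num.sqrt (\det S))%:E.
Proof.
elim: p S m => [|p IH] S m pS /=.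
  rewrite /qform (_ : rowv _ - m = 0) ?mul0mx ?mxE; last by apply/rowP; case.
  by rewrite oppr0 mul0r expR0 det_mx00 sqrtr1 expr0 divr1.
pose D := drsubmx (S : 'M[R]_(1 + p)); pose h := ursubmx (S : 'M[R]_(1 + p)) *m invmx D.
have pD : posdef D by apply: posdef_drsubmx.
have uD := posdef_unitmx pD.
have s0 : 0 < schur (S : 'M[R]_(1 + p)) by apply: schur_gt0.
set s := schur _ in s0.
pose m1 := m ord0 ord0; pose m2 := rsubmx (m : 'rV[R]_(1 + p)).
have E t (x : p.-tuple R) : expR (- qform S (rowv (cons_tuple t x) - m) / 2) =
    expR (- (s * (t - m1) ^+ 2) / 2)
    * expR (- qform D (rowv x - (m2 - (t - m1) *: h)) / 2).
  rewrite -expRD (@rowv_cons_sub p); congr expR.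
  rewrite (schur_qform (proj1 pS) uD) -/s -/D -/h -/m2.
  have -> : rowv x - (m2 - (t - m1) *: h) = rowv x - m2 + (t - m1) *: h.
    by rewrite opprB addrCA addrC.
  rewrite -/m1; lra.
under eq_integral => t _.
  under eq_fun => x do rewrite E EFinM.
  rewrite (integratorZ (integrator_iint_Rk p)); last first.
  - by rewrite lee_fin expR_ge0.
  - by move=> x; rewrite lee_fin expR_ge0.
  - by apply/measurable_EFinP; exact: measurable_gauss_fun.
  rewrite IH //.
  over.
rewrite ge0_integralZr //; last first.
  apply/measurable_EFinP; apply: measurableT_comp => //; apply: measurable_funM => //.
  apply: measurableT_comp => //; apply: measurable_funM => //.
  by apply: measurable_funX; exact: measurable_funB.
rewrite integral_gauss_1d // -EFinM; congr EFin.
rewrite (schur_det (proj1 pS) uD) -/s -/D (sqrtrM _ (ltW s0)) exprS invfM; ring.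
Qed.

Lemma posdef_invmx p (S : 'M[R]_p) : posdef S -> posdef (invmx S).
Proof.
move=> pS; have uS := posdef_unitmx pS; have [sS H] := pS.
have sI : (invmx S)^T = invmx S by rewrite trmx_inv sS.
split=> // x x0.
have y0 : x *m invmx S != 0.
  by apply: contra x0 => /eqP/(congr1 (mulmx^~ S)); rewrite mulmxKV // mul0mx => ->.
have := H _ y0; rewrite -/(qform _ _) qform_congr sI mulVmx // mul1mx.
by rewrite -/(qform _ _).
Qed.

Lemma gauss_densE p (S : 'M[R]_p) x : gauss_dens S x =
  (Num.sqrt ((2 * pi) ^+ p * \det S))^-1 * expR (- qform (invmx S) (rowv x - 0) / 2).
Proof. by rewrite subr0 mulrC. Qed.

Lemma measurable_gauss_dens p (S : 'M[R]_p) : measurable_fun setT (gauss_dens S).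
Proof.
rewrite (funext (gauss_densE S)); apply: measurable_funM => //.
exact: measurable_gauss_fun.
Qed.

Lemma gauss_dens_ge0 p (S : 'M[R]_p) x : 0 <= gauss_dens S x.
Proof. by rewrite divr_ge0 ?expR_ge0 ?sqrtr_ge0. Qed.

Lemma sqrt_2pi_gt0 p : 0 < Num.sqrt ((2 * pi) ^+ p) :> R.
Proof. by rewrite sqrtr_gt0 exprn_gt0 // mulr_gt0 // pi_gt0. Qed.

Lemma sqrtX_2pi p : Num.sqrt (2 * pi) ^+ p = Num.sqrt ((2 * pi) ^+ p) :> R.
Proof.
have pi0 : 0 <= 2 * pi :> R by rewrite mulr_ge0 ?pi_ge0.
elim: p => [|p IH]; first by rewrite !expr0 sqrtr1.
by rewrite !exprS (sqrtrM _ pi0) IH.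
Qed.

Lemma gauss_dens_gt0 p (S : 'M[R]_p) x : posdef S -> 0 < gauss_dens S x.
Proof.
move=> pS; rewrite gauss_densE mulr_gt0 ?expR_gt0 // invr_gt0 sqrtr_gt0.
by rewrite mulr_gt0 ?posdef_det_gt0 // exprn_gt0 // mulr_gt0 // pi_gt0.
Qed.

Lemma iint_scaled_gauss p (S : 'M[R]_p) (k : R) : posdef S -> 0 <= k ->
  iint_Rk (fun x => (k * expR (- qform S (rowv x - 0) / 2))%:E)
  = (k * (Num.sqrt (2 * pi) ^+ p / Num.sqrt (\det S)))%:E.
Proof.
move=> pS k0; under eq_fun do rewrite EFinM.
rewrite (integratorZ (integrator_iint_Rk p)) ?iint_gauss //.
by apply/measurable_EFinP; exact: measurable_gauss_fun.
Qed.

Lemma iint_gauss_dens p (S : 'M[R]_p) : posdef S ->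
  iint_Rk (fun x => (gauss_dens S x)%:E) = 1%E.
Proof.
move=> pS; under eq_fun do rewrite gauss_densE.
rewrite iint_scaled_gauss; [|exact: posdef_invmx|by rewrite invr_ge0 sqrtr_ge0].
have d0 := posdef_det_gt0 pS.
have pi0 : 0 <= (2 * pi) ^+ p :> R by rewrite exprn_ge0 // mulr_ge0 ?pi_ge0.
rewrite det_inv (sqrtrM _ pi0) sqrtrV ?(ltW d0) // sqrtX_2pi; congr EFin; field.
by rewrite !gt_eqF ?sqrt_2pi_gt0 ?sqrtr_gt0.
Qed.

End gaussian.

(** * Perturbations of the identity *)

(** For [S = 1 + A] the right side is [1 - A ^ 2]. This links the precision matrix [2 S^-1 - 1] of
    the chi-square integrand to the determinant that is bounded below. *)
Lemma mulmx_invD_self (K : fieldType) n (S : 'M[K]_n) : S \in unitmx ->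
  S *m (invmx S *+ 2 - 1%:M) *m S = S *+ 2 - S *m S.
Proof.
move=> uS; rewrite !mulr2n mulmxBr mulmxDr mulmxBl mulmxDl mulmx1.
by rewrite mulmxV // mul1mx.
Qed.

Section perturbation.
Context {R : realType} (p : nat).
Implicit Types (A : 'M[R]_p) (eta : R).

Definition row_sum_le eta A := forall i, \sum_j `|A i j| <= eta.

(** Schur's test: [2 |x_i x_j| <= x_i ^ 2 + x_j ^ 2], and by symmetry of [A] both halves are
    controlled by row sums. *)
Lemma qform_row_sum_le A eta x : A^T = A -> row_sum_le eta A ->
  `|qform A x| <= eta * qform 1%:M x.
Proof.
move=> sA rA; pose F i j := `|A i j| * x ord0 i ^+ 2.
have sF : \sum_i \sum_j F i j <= eta * qform 1%:M x.
  rewrite qform1 mulr_sumr ler_sum // => i _.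
  by rewrite -mulr_suml ler_wpM2r // sqr_ge0.
apply: (@le_trans _ _ ((\sum_i \sum_j F i j + \sum_i \sum_j F j i) / 2)).
  rewrite -big_split mulr_suml qformE /=.
  apply: le_trans (ler_norm_sum _ _ _) _; apply: ler_sum => i _.
  rewrite -big_split mulr_suml /=.
  apply: le_trans (ler_norm_sum _ _ _) _; apply: ler_sum => j _.
  have Aji : A j i = A i j by rewrite -{2}sA mxE.
  rewrite /F Aji !normrM -(real_normK (num_real (x ord0 i))).
  rewrite -(real_normK (num_real (x ord0 j))).
  have := mulr_ge0 (normr_ge0 (A i j)) (sqr_ge0 (`|x ord0 i| - `|x ord0 j|)); nra.
rewrite [X in _ + X]exchange_big /=; lra.
Qed.

Lemma row_sum_le_sqr A eta : row_sum_le eta A -> row_sum_le (eta ^+ 2) (A *m A).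
Proof.
move=> rA i; apply: (@le_trans _ _ (\sum_j \sum_k `|A i k| * `|A k j|)).
  apply: ler_sum => j _; rewrite mxE; apply: le_trans (ler_norm_sum _ _ _) _.
  by apply: ler_sum => k _; rewrite normrM.
have eta0 : 0 <= eta by apply: le_trans (rA i); apply: sumr_ge0.
rewrite exchange_big /=; apply: (@le_trans _ _ (\sum_k `|A i k| * eta)).
  by apply: ler_sum => k _; rewrite -mulr_sumr ler_wpM2l.
by rewrite -mulr_suml expr2 ler_wpM2r.
Qed.

Lemma mulmx_sym_self A : A^T = A -> (A *m A)^T = A *m A.
Proof. by move=> sA; rewrite trmx_mul sA. Qed.

Lemma frob2_trace A : A^T = A -> frob2 A = \sum_i (A *m A) i i.
Proof.
move=> sA; apply: eq_bigr => i _; rewrite mxE; apply: eq_bigr => j _.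
by rewrite -[in A j i]sA mxE expr2.
Qed.

Variables (A : 'M[R]_p) (eta : R).
Hypotheses (sA : A^T = A) (rA : row_sum_le eta A) (eta_half : eta <= 2^-1).

Lemma qform_perturb x : `|qform (1%:M + A) x - qform 1%:M x| <= eta * qform 1%:M x.
Proof. by rewrite qformD addrC addKr; exact: qform_row_sum_le. Qed.

Lemma posdef_perturb : posdef (1%:M + A).
Proof.
split=> [|x /qform1_gt0 x0]; first by rewrite linearD /= trmx1 sA.
rewrite -/(qform _ _); have := qform_perturb x; rewrite ler_norml => /andP[+ _].
have := ler_wpM2r (ltW x0) eta_half; lra.
Qed.

Lemma eigenvalue_perturb a : eigenvalue (1%:M + A) a -> 1 - eta <= a <= 1 + eta.
Proof.
case/eigenvalueP => v Ev v0; have := qform_perturb v.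
have -> : qform (1%:M + A) v = a * qform 1%:M v.
  by rewrite /qform Ev mulmx1 -scalemxAl mxE.
move: (qform1_gt0 v0) => n0; rewrite ler_norml => /andP[H1 H2].
rewrite -(ler_pM2r n0) -[X in _ && X](ler_pM2r n0); apply/andP; split; lra.
Qed.

Lemma qform_sqr_perturb x : 0 <= qform (A *m A) x <= 4^-1 * qform 1%:M x.
Proof.
apply/andP; split.
  rewrite -{2}sA -[X in qform (X *m _) _]mulmx1 -qform_congr; exact: qform1_ge0.
apply: le_trans (ler_norm _) _.
apply: le_trans (qform_row_sum_le _ (mulmx_sym_self sA) (row_sum_le_sqr rA)) _.
(* A row is required to see that [eta] is nonnegative; in dimension 0 the form vanishes. *)
have [i|p0] := pickP 'I_p.
  have eta0 : 0 <= eta by apply: le_trans (rA i); apply: sumr_ge0.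
  rewrite ler_wpM2r ?qform1_ge0 // expr2.
  by have := ler_pM eta0 eta0 eta_half eta_half; lra.
by rewrite qform1 big_pred0 ?mulr0.
Qed.

Lemma posdef_one_sub_sqr : posdef (1%:M - A *m A).
Proof.
split=> [|x /qform1_gt0 x0].
  by rewrite linearB /= trmx1 mulmx_sym_self.
rewrite -/(qform _ _) qformB; have /andP[_ ?] := qform_sqr_perturb x; lra.
Qed.

(* (1 - t)(1 + 2t) >= 1 for 0 <= t <= 1/2, applied to t = A^2, turns the
   determinant to be bounded below into one that Hadamard's inequality bounds
   above. *)
Lemma det_one_sub_sqr : expR (- (2 * frob2 A)) <= \det (1%:M - A *m A).
Proof.
set Q := A *m A; have sQ : Q^T = Q by exact: mulmx_sym_self.
have Q0 x : 0 <= qform Q x by case/andP: (qform_sqr_perturb x).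
have pP : posdef (1%:M + Q *+ 2).
  split=> [|x /qform1_gt0 x0]; first by rewrite linearD /= linearMn /= trmx1 sQ.
  by rewrite -/(qform _ _) qformD qformMn ltr_wpDr // mulrn_wge0.
have dP : \det (1%:M + Q *+ 2) <= expR (2 * frob2 A).
  apply: le_trans (posdef_det_le pP) _.
  rewrite frob2_trace // mulr_sumr expR_sum; apply: ler_prod => i _.
  have e0 : 0 <= Q i i.
    by rewrite mxE sumr_ge0 // => j _; rewrite -[in A j i]sA mxE -expr2 sqr_ge0.
  have -> : (1%:M + Q *+ 2) i i = 1 + 2 * Q i i.
    by rewrite mulr2n mulrDl mul1r; do 2!rewrite mxE; rewrite eqxx [(Q + Q) i i]mxE.
  by rewrite -/Q addr_ge0 ?mulr_ge0 //= expR_ge1Dx.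
have prod1 : 1 <= \det (1%:M - Q) * \det (1%:M + Q *+ 2).
  rewrite -det_mulmx.
  (* The product is [1 + Q - 2 Q ^ 2]. Written as a congruence by [A], it exceeds the identity
     because [Q] is at most [1/4] as a form. *)
  have -> : (1%:M - Q) *m (1%:M + Q *+ 2) = 1%:M + A *m (1%:M - Q *+ 2) *m A^T.
    rewrite sA mulr2n mulmxBl !mulmxDr mulmxN !mulmxDr !mul1mx !mulmx1.
    rewrite mulmxDl mulNmx mulmxDl.
    have -> : A *m Q *m A = Q *m Q by rewrite /Q !mulmxA.
    rewrite -/Q; move: (Q *m Q) (Q) => X Y.
    by apply/matrixP => i j; rewrite !mxE; ring.
  apply: det_ge1 => [|x].
    by rewrite linearD /= trmx1 !trmx_mul linearB /= linearMn /= trmx1 sQ trmxK mulmxA.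
  rewrite qformD lerDl -qform_congr qformB qformMn.
  have /andP[_] := qform_sqr_perturb (x *m A).
  have := qform1_ge0 (x *m A); rewrite -/Q; lra.
have d0 : 0 < \det (1%:M - Q) := posdef_det_gt0 posdef_one_sub_sqr.
rewrite expRN -div1r ler_pdivrMr ?expR_gt0 //.
by apply: le_trans prod1 _; rewrite ler_pM2l.
Qed.

Lemma posdef1 : posdef (1%:M : 'M[R]_p).
Proof. by split=> [|x /qform1_gt0//]; rewrite trmx1. Qed.

(** The integrand is again a Gaussian up to a constant, with precision [B = 2 S^-1 - 1]. As
    [S B S = 1 - A ^ 2], the matrix [B] is positive definite and the integral is the inverse square
    root of [det (1 - A ^ 2)]; the bound is then [det_one_sub_sqr]. *)
Lemma chi2_gauss_dens : exists2 c : R, 0 <= c <= expR (frob2 A) &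
  iint_Rk (fun x => (gauss_dens (1%:M + A) x ^+ 2 / gauss_dens 1%:M x)%:E) = c%:E.
Proof.
set S := 1%:M + A; have pS : posdef S := posdef_perturb.
have uS := posdef_unitmx pS; have sS := proj1 pS.
have sI : (invmx S)^T = invmx S by rewrite trmx_inv sS.
pose B := invmx S *+ 2 - 1%:M.
have EB : 1%:M - A *m A = S *m B *m S.
  rewrite mulmx_invD_self // mulr2n /S mulmxDl !mulmxDr !mul1mx mulmx1; move: (A *m A) => X.
  by apply/matrixP => i j; rewrite !mxE; ring.
have pB : posdef B.
  split=> [|x x0]; first by rewrite linearB /= linearMn /= sI trmx1.
  have y0 : x *m invmx S != 0.
    by apply: contra x0 => /eqP/(congr1 (mulmx^~ S)); rewrite mulmxKV // mul0mx => ->.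
  have := (proj2 posdef_one_sub_sqr) _ y0; rewrite -!/(qform _ _) qform_congr EB sI.
  by rewrite !mulmxA mulVmx // mul1mx mulmxK.
have pi0 : 0 <= (2 * pi) ^+ p :> R by rewrite exprn_ge0 // mulr_ge0 ?pi_ge0.
have dS := posdef_det_gt0 pS; have dB := posdef_det_gt0 pB.
have dA := posdef_det_gt0 posdef_one_sub_sqr.
pose c0 : R := Num.sqrt ((2 * pi) ^+ p); have c0_gt0 : 0 < c0 := sqrt_2pi_gt0 _.
exists (Num.sqrt (\det (1%:M - A *m A)))^-1.
  rewrite invr_ge0 sqrtr_ge0 /= -[expR _]invrK lef_pV2 ?posrE ?invr_gt0 ?expR_gt0 ?sqrtr_gt0 //.
  rewrite -expRN -[expR _]gtr0_norm ?expR_gt0 // -sqrtr_sqr ler_wsqrtr //.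
  have -> : expR (- frob2 A) ^+ 2 = expR (- (2 * frob2 A)).
    by rewrite expr2 -expRD; congr expR; ring.
  exact: det_one_sub_sqr.
have E x : gauss_dens S x ^+ 2 / gauss_dens 1%:M x =
    (c0^-1 / \det S) * expR (- qform B (rowv x - 0) / 2).
  rewrite !gauss_densE /B qformB qformMn invmx1 det1 mulr1 (sqrtrM _ pi0) -/c0.
  have c2 : Num.sqrt (\det S) ^+ 2 = \det S by rewrite sqr_sqrtr // ltW.
  have q0 : Num.sqrt (\det S) != 0 by rewrite gt_eqF ?sqrtr_gt0.
  rewrite -[in RHS]c2 exprMn.
  set u := qform (invmx S) _; set v := qform 1%:M _.
  rewrite (_ : - (u *+ 2 - v) / 2 = - u / 2 + (- u / 2 - - v / 2)); last by rewrite mulr2n; lra.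
  rewrite expRD expRB; field.
  by rewrite q0 !gt_eqF ?expR_gt0.
under eq_fun do rewrite E.
rewrite iint_scaled_gauss //; last by rewrite divr_ge0 ?invr_ge0 ?ltW.
congr EFin; rewrite EB !det_mulmx sqrtX_2pi -/c0.
have -> : \det S * \det B * \det S = \det S ^+ 2 * \det B by ring.
rewrite sqrtrM ?sqr_ge0 // sqrtr_sqr gtr0_norm //; field.
by rewrite (gt_eqF c0_gt0) (gt_eqF dS) gt_eqF ?sqrtr_gt0.
Qed.

End perturbation.

(** * Testing many hypotheses *)

Section testing.
Context {R : realType}.

(* If [dl < r] then AM-GM gives [f <= f ^+ 2 / (4 V f0) + V f0]. *)
Lemma testing_pointwise (dl f f0 r V : R) : 0 <= dl -> 0 <= f -> 0 < f0 ->
  0 <= r -> 0 < V ->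
  r * f <= dl * f + r / (4 * V) * (f ^+ 2 / f0) + r * V * f0 * (dl < r)%R%:R.
Proof.
move=> dl0 fge f0p r0 V0.
have q0 : 0 <= f ^+ 2 / f0 by rewrite divr_ge0 ?sqr_ge0 ?ltW.
have c0 : 0 <= r / (4 * V) by rewrite divr_ge0 // mulr_ge0 ?ltW.
case: ltP => [lt|le]; last first.
  by rewrite /= mulr0; have := ler_wpM2r fge le; have := mulr_ge0 c0 q0; lra.
have amgm : f <= (4 * V)^-1 * (f ^+ 2 / f0) + V * f0.
  have -> : (4 * V)^-1 * (f ^+ 2 / f0) + V * f0
          = f + (f - 2 * V * f0) ^+ 2 / (4 * V * f0).
    field; rewrite !gt_eqF //.
  by rewrite lerDl divr_ge0 ?sqr_ge0 // !mulr_ge0 ?ltW.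
have := ler_wpM2l r0 amgm; have := mulr_ge0 dl0 fge; rewrite mulr1; lra.
Qed.

(** The pointwise splitting is summed over [j] and integrated. The chi-square terms contribute at
    most [r / 4] per member. The indicator terms contribute at most [r * V * b], since at each point
    at most [b] of them are nonzero and [f0] has mass 1; this is at most a quarter of [r * #|J|].
    Half of the left side survives. *)
Lemma testing_bound d (T : measurableType d) I (J : finType) (f dl : J -> T -> R)
    (f0 : T -> R) (V r b : R) : integrator I ->
  0 < V -> 0 <= r -> 0 <= b ->
  (forall j, measurable_fun setT (f j)) -> (forall j, measurable_fun setT (dl j)) ->
  measurable_fun setT f0 ->
  (forall j t, 0 <= f j t) -> (forall j t, 0 <= dl j t) -> (forall t, 0 < f0 t) ->
  (forall j, I (fun t => (f j t)%:E) = 1%E) -> I (fun t => (f0 t)%:E) = 1%E ->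
  (forall j, (I (fun t => (f j t ^+ 2 / f0 t)%:E) <= V%:E)%E) ->
  (forall t, #|[pred j | (dl j t < r)%R]|%:R <= b) ->
  4 * V * b <= #|J|%:R ->
  ((r * #|J|%:R / 2)%:E <= \sum_j I (fun t => (dl j t * f j t)%:E))%E.
Proof.
move=> HI V0 r0 b0 mf mdl mf0 f_ge0 dl_ge0 f0_gt0 If If0 chi cnt Vb.
set S := (\sum_j _)%E; set M : R := #|J|%:R.
have c0 : 0 <= r / (4 * V) by rewrite divr_ge0 // mulr_ge0 ?ltW.
have q0 j t : 0 <= f j t ^+ 2 / f0 t by rewrite divr_ge0 ?sqr_ge0 ?ltW.
have mq j : measurable_fun setT (fun t => f j t ^+ 2 / f0 t).
  apply: measurable_funM; first exact: measurable_funX.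
  (* The inverse agrees with the power [- 1] at positive values, and powers are measurable. *)
  have -> : (fun t => (f0 t)^-1) = (fun t => powR (f0 t) (- 1)).
    by apply/funext => t; rewrite powR_inv1 // ltW.
  exact: (measurableT_comp (f := fun x : R => powR x (- 1)) (measurable_powR (- 1)) mf0).
have mE (g : T -> R) : measurable_fun setT g -> measurable_fun setT (fun t => (g t)%:E).
  by move=> mg; apply/measurable_EFinP.
have mdf j : measurable_fun setT (fun t => dl j t * f j t) by apply: measurable_funM.
have key : (I (fun t => \sum_j (r * f j t)%:E) <=
    I (fun t => \sum_j ((dl j t * f j t)%:E + (r / (4 * V) * (f j t ^+ 2 / f0 t))%:E)
                + (r * V * b * f0 t)%:E))%E.
  apply: (integrator_le HI).
  - by apply: emeasurable_sum => j; apply/mE/measurable_funM.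
  - apply: emeasurable_funD; last exact/mE/measurable_funM.
    apply: emeasurable_sum => j; apply: emeasurable_funD; first exact/mE.
    exact/mE/measurable_funM.
  - by move=> t; apply: sume_ge0 => j _; rewrite lee_fin mulr_ge0.
  - move=> t; rewrite sumEFin.
    under [X in (_ <= X + _)%E]eq_bigr => j _ do rewrite -EFinD.
    rewrite sumEFin -EFinD lee_fin.
    apply: (@le_trans _ _ (\sum_j (dl j t * f j t + r / (4 * V) * (f j t ^+ 2 / f0 t)
        + r * V * f0 t * (dl j t < r)%R%:R))).
      by apply: ler_sum => j _; exact: testing_pointwise.
    rewrite big_split /= lerD2l -mulr_sumr.
    have -> : \sum_j ((dl j t < r)%R%:R : R) = #|[pred j | (dl j t < r)%R]|%:R.
      by rewrite -sum1_card natr_sum [RHS]big_mkcond; apply: eq_bigr => j _; rewrite inE /=; case: ltP.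
    rewrite [X in _ <= X]mulrAC ler_wpM2l //.
    by rewrite !mulr_ge0 // ltW.
move: key; rewrite (integratorD HI); last first.
- by move=> t; rewrite lee_fin !mulr_ge0 // ltW.
- by move=> t; apply: sume_ge0 => j _; apply: adde_ge0; rewrite lee_fin mulr_ge0.
- exact/mE/measurable_funM.
- apply: emeasurable_sum => j; apply: emeasurable_funD; first exact/mE.
  exact/mE/measurable_funM.
rewrite !(integrator_sum _ HI); last first.
- by move=> j t; rewrite lee_fin mulr_ge0.
- by move=> j; apply/mE/measurable_funM.
- by move=> j t; apply: adde_ge0; rewrite lee_fin mulr_ge0.
- by move=> j; apply: emeasurable_funD; [exact/mE|exact/mE/measurable_funM].
have IZ (k : R) (g : T -> R) : 0 <= k -> measurable_fun setT g -> (forall t, 0 <= g t) ->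
    I (fun t => (k * g t)%:E) = (k%:E * I (fun t => (g t)%:E))%E.
  move=> k0 mg g0; rewrite -(integratorZ HI) //; first exact: mE.
have rVb : 0 <= r * V * b by rewrite !mulr_ge0 // ltW.
rewrite (IZ (r * V * b)) // ?If0 ?mule1; last by move=> t; exact: ltW.
under eq_bigr => j _ do rewrite IZ // If mule1.
rewrite sumEFin sumr_const -[#|_|]/(#|J|) => key.
have {}key : ((r * M)%:E <= S + (r * M / 2)%:E)%E.
  have -> : r * M = r *+ #|J| by rewrite mulr_natr.
  apply: le_trans key _.
  apply: (@le_trans _ _ (\sum_j (I (fun t => (dl j t * f j t)%:E) + (r / 4)%:E)
     + (r * V * b)%:E)%E).
    apply: leeD => //; apply: lee_sum => j _.
    rewrite (integratorD HI); last first.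
    - by move=> t; rewrite lee_fin mulr_ge0.
    - by move=> t; rewrite lee_fin mulr_ge0.
    - exact/mE/measurable_funM.
    - exact/mE.
    apply: leeD => //; rewrite IZ //.
    apply: le_trans (lee_wpmul2l _ (chi j)) _; first by rewrite lee_fin.
    rewrite -EFinM lee_fin le_eqVlt; apply/orP; left; apply/eqP; field.
    by rewrite gt_eqF.
  rewrite big_split /= sumEFin -addeA leeD2l // -EFinD lee_fin.
  rewrite sumr_const -[#|_|]/(#|J|) -[(_ *+ _)%R]mulr_natr -/M.
  by have := ler_wpM2l r0 Vb; rewrite -/M; lra.
move: key; rewrite -leeBlDr // -EFinB; apply: le_trans.
rewrite lee_fin; lra.
Qed.

End testing.

(** * From testing to the minimax risk *)

Section minimax.
Context {R : realType}.

Lemma offdiag_nnz_perturb p (A : 'M[R]_p) : offdiag_nnz (1%:M + A) = offdiag_nnz A.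
Proof.
rewrite /offdiag_nnz; congr (#|(_ : set ('I_p * 'I_p))|).
apply/funext => -[i j] /=; congr is_true.
by case: eqVneq => //= ij; rewrite mxE [X in X + _]mxE (negbTE ij) add0r.
Qed.

Lemma frob2_ge0 p (A : 'M[R]_p) : 0 <= frob2 A.
Proof. by do 2!apply: sumr_ge0 => ? _; rewrite sqr_ge0. Qed.

Lemma Uclass_perturb p s0 (tau0 eta : R) (A : 'M[R]_p) :
  A^T = A -> row_sum_le eta A -> eta <= 2^-1 ->
  tau0^-1 <= 1 - eta -> 1 + eta <= tau0 -> (offdiag_nnz A <= s0)%N ->
  Uclass s0 tau0 (1%:M + A).
Proof.
move=> sA rA eh lo hi nA; split; first exact: (@posdef_perturb _ _ _ eta).
rewrite offdiag_nnz_perturb; split=> // a.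
move=> /(eigenvalue_perturb sA rA) /andP[l u].
by rewrite (le_trans lo l) (le_trans u hi).
Qed.

Section sample.
Variables (p n : nat).

Lemma measurable_sample_dens (S : 'M[R]_p) :
  measurable_fun setT (fun X : n.-tuple (p.-tuple R) => \prod_(i < n) gauss_dens S (tnth X i)).
Proof.
apply: measurable_prod => i _.
by apply: measurableT_comp; [exact: measurable_gauss_dens|exact: measurable_tnth].
Qed.

Lemma iint_sample_dens (S : 'M[R]_p) : posdef S ->
  iint_sample (fun X : n.-tuple (p.-tuple R) =>
    (\prod_(i < n) gauss_dens S (tnth X i))%:E) = 1%E.
Proof.
move=> pS; rewrite iint_sampleE (tuple_iter_prod n (c := 1)) ?expr1n //.
- exact: integrator_iint_Rk.
- exact: measurable_gauss_dens.
- exact: gauss_dens_ge0.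
- exact: iint_gauss_dens.
Qed.

(** The chi-square integral is multiplicative over independent observations. *)
Lemma chi2_sample_dens (A : 'M[R]_p) eta W :
  A^T = A -> row_sum_le eta A -> eta <= 2^-1 -> frob2 A <= W ->
  (iint_sample (fun X : n.-tuple (p.-tuple R) =>
    ((\prod_(i < n) gauss_dens (1%:M + A) (tnth X i)) ^+ 2
      / \prod_(i < n) gauss_dens 1%:M (tnth X i))%:E) <= (expR (n%:R * W))%:E)%E.
Proof.
move=> sA rA eh fA.
have [c /andP[c0 c1] Hc] := chi2_gauss_dens sA rA eh.
pose g x := gauss_dens (1%:M + A) x ^+ 2 / gauss_dens 1%:M x.
have E (X : n.-tuple (p.-tuple R)) : (\prod_(i < n) gauss_dens (1%:M + A) (tnth X i)) ^+ 2
      / \prod_(i < n) gauss_dens 1%:M (tnth X i) = \prod_(i < n) g (tnth X i).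
  by rewrite -prodrXl -prodf_div.
under eq_fun do rewrite E.
rewrite iint_sampleE (tuple_iter_prod n (integrator_iint_Rk p) _ _ Hc).
- rewrite lee_fin expRM_natl lerXn2r ?nnegrE ?expR_ge0 //.
  by apply: le_trans c1 _; rewrite ler_expR.
- apply: measurable_funM; first by apply: measurable_funX; exact: measurable_gauss_dens.
  have -> : (fun x : p.-tuple R => (gauss_dens 1%:M x)^-1)
          = (fun x => powR (gauss_dens 1%:M x) (- 1)).
    by apply/funext => t; rewrite powR_inv1 // gauss_dens_ge0.
  apply: (measurableT_comp (f := fun x : R => powR x (- 1)) (measurable_powR (- 1))).
  exact: measurable_gauss_dens.
- by move=> x; rewrite divr_ge0 ?sqr_ge0 ?gauss_dens_ge0.
Qed.

(** The supremum of the risk dominates its average over the family, to which [testing_bound] applies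
    with the standard Gaussian sample as reference. *)
Lemma minimax_lower (s0 : nat) (tau0 eta W r b : R) (J : finType) (A : J -> 'M[R]_p) :
  (forall j, (A j)^T = A j) -> (forall j, row_sum_le eta (A j)) -> eta <= 2^-1 ->
  tau0^-1 <= 1 - eta -> 1 + eta <= tau0 -> (forall j, (offdiag_nnz (A j) <= s0)%N) ->
  (forall j, frob2 (A j) <= W) -> (0 < #|J|)%N -> 0 <= r -> 0 <= b ->
  (forall B : 'M[R]_p, #|[pred j | (frob2 (B - A j) < r)%R]|%:R <= b) ->
  4 * expR (n%:R * W) * b <= #|J|%:R ->
  ((r / 2)%:E <= minimax_risk p n s0 tau0)%E.
Proof.
move=> sA rA eh lo hi nA fA J0 r0 b0 cnt Vb.
apply: le_ereal_inf_tmp => _ [Sh mSh <-].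
set u := ereal_sup _.
have HI := @integrator_iint_sample R p n.
have le_u j : (risk Sh (1%:M + A j) <= u)%E.
  apply: ereal_sup_ubound; exists (1%:M + A j) => //.
  exact: (@Uclass_perturb _ _ _ eta).
have risk0 j : (0 <= risk Sh (1%:M + A j))%E.
  apply: (integrator_ge0 HI) => X; rewrite lee_fin mulr_ge0 ?frob2_ge0 //.
  by apply: prodr_ge0 => i _; rewrite gauss_dens_ge0.
have sum_le : ((r * #|J|%:R / 2)%:E <= \sum_j risk Sh (1%:M + A j))%E.
  apply: (testing_bound (V := expR (n%:R * W)) (b := b) HI
    (f := fun j X => \prod_(i < n) gauss_dens (1%:M + A j) (tnth X i))
    (f0 := fun X => \prod_(i < n) gauss_dens 1%:M (tnth X i))
    (dl := fun j X => frob2 (Sh X - (1%:M + A j)))) => //.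
  - exact: expR_gt0.
  - by move=> j; exact: measurable_sample_dens.
  - move=> j; apply: measurable_sum => i; apply: measurable_sum => k.
    apply: measurable_funX.
    have -> : (fun X => (Sh X - (1%:M + A j)) i k) =
              (fun X => Sh X i k - (1%:M + A j) i k).
      by apply/funext => X; rewrite mxE [X in _ + X = _]mxE.
    by apply: measurable_funB => //; exact: mSh.
  - exact: measurable_sample_dens.
  - by move=> j X; apply: prodr_ge0 => i _; exact: gauss_dens_ge0.
  - by move=> j X; exact: frob2_ge0.
  - by move=> X; apply: prodr_gt0 => i _; apply: gauss_dens_gt0; exact: posdef1.
  - by move=> j; apply: iint_sample_dens; exact: (@posdef_perturb _ _ _ eta).
  - exact/iint_sample_dens/posdef1.
  - by move=> j; exact: (@chi2_sample_dens _ eta).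
  (* A ball around the estimate among the [1 + A j] is a ball around its translate by the identity
     among the [A j]. *)
  - move=> X; apply: le_trans (cnt (Sh X - 1%:M)); rewrite ler_nat.
    apply: subset_leq_card; apply/fintype.subsetP => j; rewrite !inE.
    by rewrite opprD addrA.
have M0 : (0 : R) < #|J|%:R by rewrite ltr0n.
have : ((r * #|J|%:R / 2)%:E <= \sum_(j : J) u)%E.
  by apply: le_trans sum_le _; apply: lee_sum.
(* A member of the family makes [u] nonnegative, which leaves a real value or [+oo]. *)
have [j _] : exists j : J, true by case/card_gt0P: J0 => j _; exists j.
move: (le_trans (risk0 j) (le_u j)); case: u {le_u} => [x| |] // x0.
  rewrite sumEFin !lee_fin sumr_const -[x *+ _]mulr_natr.
  have -> : r * #|J|%:R / 2 = r / 2 * #|J|%:R by ring.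
  by rewrite ler_pM2r.
by move=> _; rewrite leey.
Qed.

End sample.
End minimax.

(** * Counting agreements *)

Section packing.
Context {R : realType}.

Lemma frob2_triangle p (B C D : 'M[R]_p) :
  frob2 (C - D) <= 2 * frob2 (B - C) + 2 * frob2 (B - D).
Proof.
rewrite /frob2 -!mulrDr -big_split /= mulr_sumr; apply: ler_sum => i _.
rewrite -big_split /= mulr_sumr; apply: ler_sum => j _.
rewrite !mxE; set x := B i j; set y := C i j; set z := D i j.
have := sqr_ge0 ((x - y) + (x - z)); nra.
Qed.

(** Two members of one ball are at squared distance below [a ^+ 2 * N%:R / 2], so they agree in at
    least [N / 2] places. Each member thus adds at least [y ^+ N] to the exponential sum around a
    fixed one, as in Markov's inequality. *)
Lemma packing_card p (J : finType) (A : J -> 'M[R]_p) (agr : J -> J -> nat) (N : nat)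
    (a y Y : R) : 1 <= y -> 0 <= Y ->
  (forall i j, a ^+ 2 * (N%:R - (agr i j)%:R) <= frob2 (A i - A j)) ->
  (forall i, \sum_j (y ^+ 2) ^+ agr i j <= Y) ->
  forall B, #|[pred j | (frob2 (B - A j) < a ^+ 2 * N%:R / 8)%R]|%:R <= Y / y ^+ N.
Proof.
move=> y1 Y0 dist gen B; set P := [pred j | _].
have y0 : 0 < y by exact: lt_le_trans y1.
rewrite ler_pdivlMr ?exprn_gt0 //.
have [j0 j0P|P0] := pickP P; last by rewrite (eq_card0 P0) mul0r.
apply: le_trans (gen j0).
rewrite -sum1_card natr_sum mulr_suml [X in X <= _]big_mkcond; apply: ler_sum => j _.
have yj : 0 <= (y ^+ 2) ^+ agr j0 j by rewrite !exprn_ge0 // ltW.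
case: ifP => // jP; rewrite mul1r -exprM.
apply: ler_weXn2l => //; rewrite leqNgt; apply/negP => lt.
have lt' : 2 * (agr j0 j)%:R < N%:R :> R by rewrite -natrM ltr_nat.
have := dist j0 j; have := frob2_triangle B (A j0) (A j).
move: j0P jP; rewrite !inE => H1 H2 H3 H4.
have := sqr_ge0 a; nra.
Qed.

Lemma sum_exp_agree (I T : finType) (z : R) (f : {ffun I -> T}) :
  \sum_(g : {ffun I -> T}) z ^+ (\sum_i (f i == g i)) =
  \prod_i \sum_t z ^+ (f i == t).
Proof.
by rewrite bigA_distr_bigA /=; apply: eq_bigr => g _; rewrite -prodrXr.
Qed.

End packing.

Section permutations.
Context {R : realType} (q : nat).

(** Composition with the inverse of [s] turns agreement on [T] into fixing [T] pointwise, which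
    leaves a permutation of the complement. *)
Lemma card_perm_agree (T : {set 'I_q}) (s : {perm 'I_q}) :
  (#|[pred t : {perm 'I_q} | [forall x in T, s x == t x]]| <= (q - #|T|)`!)%N.
Proof.
have -> : (q - #|T|)%N = #|~: T| by have := cardsC T; rewrite card_ord; lia.
rewrite -card_perm -(card_imset _ (mulIg s^-1)%g).
apply: subset_leq_card; apply/fintype.subsetP => u /imsetP[t].
rewrite inE => /forall_inP H ->; rewrite unfold_in; apply/fintype.subsetP => x.
rewrite !inE; apply: contra => xT.
by rewrite permM -(eqP (H x xT)) permK.
Qed.

(** Expanding [(1 + q)] to the number of agreements gives a sum over sets [T] of agreement points.
    Each [T] contributes at most [(q - |T|)! q ^ |T| <= q! q ^ |T| / |T|! <= q! e ^ q], and there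
    are [2 ^ q <= e ^ q] sets. *)
Lemma sum_perm_agree (s : {perm 'I_q}) :
  \sum_(t : {perm 'I_q}) q.+1%:R ^+ (\sum_x (s x == t x)) <= q`!%:R * expR (2 * q%:R) :> R.
Proof.
have E (t : {perm 'I_q}) : q.+1%:R ^+ (\sum_x (s x == t x)) =
    \sum_(T : {set 'I_q}) if [forall x in T, s x == t x] then q%:R ^+ #|T| else 0 :> R.
  rewrite -prodrXr.
  transitivity (\prod_x ((if s x == t x then q%:R else 0) + 1 : R)).
    apply: eq_bigr => x _; case: eqP => _ /=; last by rewrite expr0 add0r.
    by rewrite expr1 -natr1.
  rewrite bigA_distr /=; apply: eq_bigr => T _.
  case: ifPn => [/forall_inP H|].
    rewrite -prodr_const [RHS]big_mkcond /=; apply: eq_bigr => x _.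
    by case: ifP => // /H ->.
  rewrite negb_forall => /existsP[x]; rewrite negb_imply => /andP[xT sx].
  by rewrite (bigD1 x) //= xT (negbTE sx) mul0r.
under eq_bigr do rewrite E.
rewrite exchange_big /=.
apply: (@le_trans _ _ (\sum_(T : {set 'I_q}) q`!%:R * expR q%:R)).
  apply: ler_sum => T _; rewrite -big_mkcond /= sumr_const -[_ *+ _]mulr_natl.
  have Tq : (#|T| <= q)%N by rewrite -[X in (_ <= X)%N]card_ord max_card.
  apply: (@le_trans _ _ ((q - #|T|)`!%:R * q%:R ^+ #|T|)).
    by rewrite ler_wpM2r ?exprn_ge0 // ler_nat card_perm_agree.
  have f0 : 0 < (#|T|)`!%:R :> R by rewrite ltr0n fact_gt0.
  have -> : (q - #|T|)`!%:R * q%:R ^+ #|T| =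
      ((q - #|T|)`! * (#|T|)`!)%:R * (q%:R ^+ #|T| / (#|T|)`!%:R) :> R.
    by rewrite natrM; field; rewrite gt_eqF.
  apply: ler_pM.
  - by rewrite ler0n.
  - by rewrite divr_ge0 ?exprn_ge0.
  - by rewrite ler_nat -(bin_fact Tq) [X in (X <= _)%N]mulnC leq_pmull // bin_gt0.
  case: #|T| => [|m]; first by rewrite fact0 expr0 divr1 -expR0 ler_expR.
  by have := expR_ge1Dxn m (ler0n R q); lra.
rewrite sumr_const -cardsT -powersetT card_powerset cardsT card_ord -[_ *+ _]mulr_natr -mulrA ler_wpM2l // natrX.
rewrite [2 * q%:R]mulr_natl mulr2n expRD ler_wpM2l ?expR_ge0 //.
rewrite -[q%:R]mulr1 expRM_natl lerXn2r ?nnegrE ?expR_ge0 //.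
by have := expR_ge1Dx (1 : R); lra.
Qed.

End permutations.

(** * The diagonal family *)

Section diagonal_family.
Context {R : realType} (p m : nat) (a : R).

(** Each entry has [m] levels, so that with a large [m] chance agreements are rare enough to offset
    the chi-square bound. *)
Definition diag_family (th : {ffun 'I_p -> 'I_m}) : 'M[R]_p :=
  diag_mx (\row_i (a * (th i)%:R)).

Lemma diag_familyE th i j : diag_family th i j = (a * (th i)%:R) *+ (i == j).
Proof. by rewrite !mxE; case: eqVneq => [->|]. Qed.

Lemma tr_diag_family th : (diag_family th)^T = diag_family th.
Proof. exact: tr_diag_mx. Qed.

Lemma sum_diag (F : 'I_p -> R) i : \sum_j (F i *+ (i == j)) = F i.
Proof.
by rewrite (bigD1 i) //= eqxx big1 ?addr0 // => j; rewrite eq_sym => /negbTE ->.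
Qed.

Lemma row_sum_diag_family th : 0 <= a -> row_sum_le (m%:R * a) (diag_family th).
Proof.
move=> a0 i; under eq_bigr => j _.
  rewrite diag_familyE normrMn ger0_norm; last by rewrite mulr_ge0.
  over.
rewrite (sum_diag (fun i => a * (th i)%:R)) mulrC ler_wpM2r //.
by rewrite ler_nat ltnW.
Qed.

Lemma offdiag_nnz_diag_family th : offdiag_nnz (diag_family th) = 0%N.
Proof.
apply: eq_card0 => -[i j]; apply/negbTE; rewrite notin_setE /= diag_familyE.
by case: eqVneq => //= _; rewrite eqxx.
Qed.

Lemma frob2_diag_family th th' :
  frob2 (diag_family th - diag_family th') =
  a ^+ 2 * \sum_i ((th i)%:R - (th' i)%:R) ^+ 2.
Proof.
rewrite mulr_sumr; apply: eq_bigr => i _.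
rewrite -[RHS](sum_diag (fun i => a ^+ 2 * ((th i)%:R - (th' i)%:R) ^+ 2)); apply: eq_bigr => j _.
rewrite mxE [X in _ + X]mxE !diag_familyE; case: eqP => _ /=; rewrite ?mulr1n ?mulr0n; ring.
Qed.

Lemma frob2_diag_family_le th : frob2 (diag_family th) <= (m%:R * a) ^+ 2 * p%:R.
Proof.
have -> : frob2 (diag_family th) = a ^+ 2 * \sum_i (th i)%:R ^+ 2.
  rewrite mulr_sumr; apply: eq_bigr => i _.
  rewrite -[RHS](sum_diag (fun i => a ^+ 2 * (th i)%:R ^+ 2)); apply: eq_bigr => j _.
  by rewrite diag_familyE; case: eqP => _ /=; rewrite ?mulr1n ?mulr0n ?expr0n // exprMn.
have -> : (m%:R * a) ^+ 2 * p%:R = a ^+ 2 * (m%:R ^+ 2 * p%:R) by rewrite exprMn; ring.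
rewrite ler_wpM2l ?sqr_ge0 //.
apply: (@le_trans _ _ (\sum_(i < p) m%:R ^+ 2)); last first.
  by rewrite sumr_const card_ord mulr_natr.
apply: ler_sum => i _; rewrite lerXn2r ?nnegrE //.
by rewrite ler_nat ltnW.
Qed.

Lemma frob2_diag_family_ge (th th' : {ffun 'I_p -> 'I_m}) :
  a ^+ 2 * (p%:R - (\sum_i (th i == th' i))%N%:R) <= frob2 (diag_family th - diag_family th').
Proof.
rewrite frob2_diag_family ler_wpM2l ?sqr_ge0 // lerBlDr natr_sum -big_split /=.
rewrite -[X in X%:R]card_ord -sum1_card natr_sum; apply: ler_sum => i _.
case: eqP => [->|/eqP ne]; first by rewrite subrr expr0n /= add0r.
rewrite addr0 -real_normK ?num_real // exprn_ege1 //.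
case: (ltngtP (th i) (th' i)) => [lt|lt|e]; last by move/val_inj: e ne => ->; rewrite eqxx.
  by rewrite distrC ger0_norm -?natrB ?ler1n ?subn_gt0 // ltnW.
by rewrite ger0_norm -?natrB ?ler1n ?subn_gt0 // ltnW.
Qed.

(** Coordinates are independent; in each, one level agrees and has weight [z], and the others have
    weight 1. *)
Lemma sum_agree_diag_family (z : R) (th : {ffun 'I_p -> 'I_m}) : 0 <= z ->
  \sum_(th' : {ffun 'I_p -> 'I_m}) z ^+ (\sum_i (th i == th' i))
    <= (z + m%:R) ^+ p.
Proof.
move=> z0; rewrite sum_exp_agree -[X in _ <= _ ^+ X]card_ord -prodr_const; apply: ler_prod => i _.
apply/andP; split; first by apply: sumr_ge0 => t _; rewrite exprn_ge0.
rewrite (bigD1 (th i)) //= eqxx expr1.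
apply: (@le_trans _ _ (z + \sum_(t : 'I_m) 1)); last by rewrite sumr_const card_ord.
rewrite lerD2l [X in X <= _]big_mkcond; apply: ler_sum => t _.
by rewrite eq_sym; case: eqP => //= _; rewrite expr0.
Qed.

End diagonal_family.

Section diagonal_bound.
Context {R : realType}.

Lemma minimax_diag (p n s0 : nat) (tau0 eta : R) : (0 < p)%N -> (0 < n)%N ->
  0 <= eta -> eta <= 2^-1 -> tau0^-1 <= 1 - eta -> 1 + eta <= tau0 ->
  1 <= 4 * eta ^+ 2 * n%:R ->
  ((p%:R / n%:R / (64 * 16 ^+ 4))%:E <= minimax_risk p n s0 tau0)%E.
Proof.
move=> p0 n0 eta0 eh lo hi neta.
have nR : (0 : R) < n%:R by rewrite ltr0n.
(* The final comparison reduces to [16 * y <= y ^+ 2], which dictates [y = 16]; taking [m = y ^ 2]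
   balances the two terms of [y ^+ 2 + m%:R]. *)
pose y : R := 16%:R; pose m := (16 ^ 2)%N.
have y0 : 0 < y by rewrite ltr0n.
have y16 : 16%:R <= y by [].
have my : m%:R = y ^+ 2 by rewrite natrX.
have m0 : (0 < m)%N by rewrite expn_gt0.
rewrite -[16 in X in (X%:E <= _)%E]/y.
clearbody y m.
(* With this scale [m * a] is [1 / (2 sqrt n)], at most [eta] by [neta], and the chi-square exponent
   is [p / 4]. *)
pose a : R := (2 * y ^+ 2 * Num.sqrt n%:R)^-1.
have sn : 0 < Num.sqrt n%:R :> R by rewrite sqrtr_gt0.
have a0 : 0 <= a by rewrite invr_ge0 !mulr_ge0 ?exprn_ge0 ?ltW.
have a2 : a ^+ 2 = (4 * y ^+ 4 * n%:R)^-1.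
  by rewrite /a exprVn exprMn sqr_sqrtr ?ltW //; congr (_ * _)^-1; ring.
have aeta : m%:R * a <= eta.
  have ya0 : 0 <= y ^+ 2 * a by rewrite mulr_ge0 ?sqr_ge0.
  rewrite my -(@ler_pXn2r _ 2) ?nnegrE // exprMn a2.
  rewrite (_ : _ * _ = (4 * n%:R)^-1); last by field; rewrite !gt_eqF.
  by rewrite -div1r ler_pdivrMr ?mulr_gt0 // mulrCA mulrA.
have rA th : row_sum_le eta (@diag_family R p m a th).
  by move=> i; apply: le_trans (row_sum_diag_family th a0 i) _.
apply: le_trans (minimax_lower (n := n) (s0 := s0) (r := a ^+ 2 * p%:R / 8)
  (b := (y ^+ 2 + m%:R) ^+ p / y ^+ p) (@tr_diag_family R p m a) rA eh lo hi _
  (@frob2_diag_family_le R p m a) _ _ _ _ _).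
- by rewrite lee_fin a2 le_eqVlt; apply/orP; left; apply/eqP; field; rewrite !gt_eqF.
- by move=> th; rewrite offdiag_nnz_diag_family.
- by rewrite card_ffun !card_ord expn_gt0 m0.
- by rewrite divr_ge0 // mulr_ge0 ?sqr_ge0.
- by rewrite divr_ge0 // exprn_ge0 ?addr_ge0 ?sqr_ge0 // ltW.
- apply: (packing_card (agr := fun th th' : {ffun 'I_p -> 'I_m} => (\sum_i (th i == th' i))%N)).
  + by apply: le_trans y16; rewrite ler1n.
  + by rewrite exprn_ge0 ?addr_ge0 ?sqr_ge0.
  + exact: frob2_diag_family_ge.
  + by move=> th; apply: sum_agree_diag_family; rewrite sqr_ge0.
rewrite card_ffun !card_ord natrX my -expr_div_n.
have -> : n%:R * ((y ^+ 2 * a) ^+ 2 * p%:R) = p%:R * 4^-1.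
  by rewrite exprMn a2; field; rewrite !gt_eqF.
rewrite expRM_natl.
have e4 : expR (4^-1 : R) <= 2.
  have : 1 + - 4^-1 <= expR (- 4^-1 : R) := expR_ge1Dx _.
  rewrite expRN -[(expR _)^-1]div1r ler_pdivlMr ?expR_gt0 //; have := expR_ge0 (4^-1 : R); lra.
have -> : (y ^+ 2 + y ^+ 2) / y = 2 * y by field; rewrite gt_eqF.
(* As [p] is positive, the factor 4 is at most [4 ^+ p], and only [p]-th powers remain. *)
apply: (@le_trans _ _ (4 ^+ p * 2 ^+ p * (2 * y) ^+ p)).
  rewrite ler_wpM2r ?exprn_ge0 ?mulr_ge0 ?(ltW y0) //; apply: ler_pM; rewrite ?exprn_ge0 ?expR_ge0 //.
    by rewrite -[X in X <= _]expr1 ler_weXn2l // ler1n.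
  by rewrite lerXn2r ?nnegrE ?expR_ge0.
rewrite -!exprMn lerXn2r ?nnegrE ?mulr_ge0 ?(ltW y0) ?sqr_ge0 //.
by rewrite expr2 [4 * 2 * _]mulrA ler_pM2r //; apply: le_trans y16; rewrite -!natrM.
Qed.

End diagonal_bound.

(** * The bipartite family *)

Section bipartite_family.
Context {R : realType} (p k q : nat) (a : R).

Local Notation vertex := (bool * ('I_k * 'I_q))%type.
Local Notation param := {ffun 'I_k * 'I_k -> {perm 'I_q}}.

Hypothesis vertex_le : (#|{: vertex}| <= p)%N.

(** The vertices occupy the first indices; any further index is isolated in [ord_adj]. *)
Definition vertex_ord (u : vertex) : 'I_p := widen_ord vertex_le (enum_rank u).

Lemma vertex_ord_inj : injective vertex_ord.
Proof.
by move=> u v /(congr1 val) /= uv; apply: enum_rank_inj; exact: val_inj.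
Qed.

(* Each side of the graph is cut into [k] blocks of size [q], and any two
   blocks on opposite sides are joined by the matching of a permutation, so
   that every vertex has exactly [k] neighbours. *)
Definition adj (th : param) (u v : vertex) : bool :=
  if u.1 then ~~ v.1 && (th (v.2.1, u.2.1) v.2.2 == u.2.2)
  else v.1 && (th (u.2.1, v.2.1) u.2.2 == v.2.2).

Lemma adj_sym th u v : adj th u v = adj th v u.
Proof. by rewrite /adj; case: u v => [[] [? ?]] [[] [? ?]]. Qed.

Definition ord_adj (th : param) (i j : 'I_p) : bool :=
  [exists u, exists v, [&& vertex_ord u == i, vertex_ord v == j & adj th u v]].

Lemma ord_adjP th i j : reflect
  (exists u v, [/\ vertex_ord u = i, vertex_ord v = j & adj th u v]) (ord_adj th i j).
Proof.
apply: (iffP existsP) => -[u].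
  by move=> /existsP[v /and3P[/eqP ? /eqP ? ?]]; exists u, v.
by move=> [v [<- <- ?]]; exists u; apply/existsP; exists v; rewrite !eqxx.
Qed.

Lemma ord_adj_vertex th u v : ord_adj th (vertex_ord u) (vertex_ord v) = adj th u v.
Proof.
apply/ord_adjP/idP => [[u' [v' [/vertex_ord_inj -> /vertex_ord_inj -> //]]]|uv].
by exists u, v.
Qed.

Lemma ord_adj_sym th i j : ord_adj th i j = ord_adj th j i.
Proof.
by apply/ord_adjP/ord_adjP => -[u [v [? ? ?]]]; exists v, u; split=> //; rewrite adj_sym.
Qed.

(** A permutation matches a vertex with exactly one vertex of each opposite block, so a neighbour is
    known by its block. The degree bound [k] follows. *)
Lemma adj_inj th u : {in [pred v | adj th u v] &, injective (fun v : vertex => v.2.1)}.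
Proof.
case: u => [[] [c x]] [[] [d y]] [[] [d' y']]; rewrite !inE /adj //= => + + e.
  by rewrite -e => /eqP <- /eqP /perm_inj ->.
by rewrite -e => /eqP -> /eqP ->.
Qed.

Lemma ord_adj_deg th i : (#|[pred j | ord_adj th i j]| <= k)%N.
Proof.
have [j0 /ord_adjP[u [_ [ui _ _]]]|P0] := pickP [pred j | ord_adj th i j]; last first.
  by rewrite (eq_card0 P0).
apply: (@leq_trans #|[pred v | adj th u v]|); last first.
  rewrite -[X in (_ <= X)%N]card_ord -(card_in_imset (@adj_inj th u)).
  exact: max_card.
apply: leq_trans (leq_image_card vertex_ord _).
apply: subset_leq_card; apply/fintype.subsetP => j; rewrite inE => /ord_adjP[u' [v [ui' <-]]].
by move: ui'; rewrite -ui => /vertex_ord_inj -> uv; apply: map_f; rewrite mem_enum inE.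
Qed.

Definition graph_family (th : param) : 'M[R]_p := \matrix_(i, j) (a *+ ord_adj th i j).

Lemma tr_graph_family th : (graph_family th)^T = graph_family th.
Proof. by apply/matrixP => i j; rewrite !mxE ord_adj_sym. Qed.

Lemma sum_ord_adj_le th i (z : R) : 0 <= z -> \sum_j (z *+ ord_adj th i j) <= z * k%:R.
Proof.
move=> z0.
apply: (@le_trans _ _ (z *+ #|[pred j | ord_adj th i j]|)).
  rewrite -sum1_card -sumrMnr [X in _ <= X]big_mkcond; apply: ler_sum => j _.
  by rewrite inE; case: ifP.
by rewrite -[z *+ _]mulr_natr ler_wpM2l // ler_nat ord_adj_deg.
Qed.

Lemma row_sum_graph_family th : 0 <= a -> row_sum_le (a * k%:R) (graph_family th).
Proof.
move=> a0 i; apply: le_trans (sum_ord_adj_le th i a0).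
by apply: ler_sum => j _; rewrite mxE normrMn ger0_norm.
Qed.

Lemma frob2_graph_family_le th : frob2 (graph_family th) <= a ^+ 2 * (p * k)%:R.
Proof.
apply: (@le_trans _ _ (\sum_(i < p) a ^+ 2 * k%:R)); last first.
  by rewrite sumr_const card_ord -[_ *+ _]mulr_natr natrM -mulrA [_ * p%:R]mulrC.
apply: ler_sum => i _; apply: le_trans (sum_ord_adj_le th i (sqr_ge0 a)).
by apply: ler_sum => j _; rewrite mxE; case: ord_adj; rewrite ?mulr1n ?mulr0n ?expr0n.
Qed.

Lemma offdiag_nnz_graph_family th : (offdiag_nnz (graph_family th) <= p * k)%N.
Proof.
apply: (@leq_trans #|[pred ij : 'I_p * 'I_p | ord_adj th ij.1 ij.2]|).
  apply: subset_leq_card; apply/fintype.subsetP => -[i j].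
  rewrite in_setE /= => /andP[_]; rewrite mxE inE /=.
  by case: ord_adj => //; rewrite mulr0n eqxx.
rewrite -sum1_card big_mkcond -(pair_bigA _ (fun i j => if ord_adj th i j then 1%N else 0%N)) /=.
apply: (@leq_trans (\sum_(i < p) k)%N); last by rewrite sum_nat_const card_ord.
apply: leq_sum => i _; apply: leq_trans (ord_adj_deg th i).
by rewrite -sum1_card [X in (_ <= X)%N]big_mkcond.
Qed.

Definition agree (th th' : param) : nat := (\sum_c \sum_x (th c x == th' c x))%N.

(** Only the entries at edges of [th], read from the [false] side to the [true] side, are kept: they
    are distinct, and each edge absent from [th'] contributes [a ^+ 2]. *)
Lemma frob2_graph_family_ge (th th' : param) :
  a ^+ 2 * ((k * k * q)%:R - (agree th th')%:R) <= frob2 (graph_family th - graph_family th').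
Proof.
pose h (t : 'I_k * 'I_k * 'I_q) : 'I_p * 'I_p :=
  (vertex_ord (false, (t.1.1, t.2)), vertex_ord (true, (t.1.2, th t.1 t.2))).
have h_inj : injective h.
  move=> [[c d] x] [[c' d'] x'] e.
  have /= /vertex_ord_inj[-> ->] := congr1 fst e.
  by have /= /vertex_ord_inj[-> _] := congr1 snd e.
pose F (ij : 'I_p * 'I_p) : R := ((graph_family th - graph_family th') ij.1 ij.2) ^+ 2.
have F0 ij : 0 <= F ij by rewrite sqr_ge0.
have -> : frob2 (graph_family th - graph_family th') = \sum_ij F ij.
  by rewrite /frob2 pair_bigA.
apply: (@le_trans _ _ (\sum_t F (h t))); last first.
  have -> : \sum_t F (h t) = \sum_(ij in h @: predT) F ij.
    by rewrite big_imset //; exact: in2W.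
  rewrite [X in _ <= X](bigID (mem (h @: predT))) /=.
  by rewrite lerDl sumr_ge0.
have -> : \sum_t F (h t) = \sum_t a ^+ 2 *+ (th t.1 t.2 != th' t.1 t.2).
  apply: eq_bigr => -[[c d] x] _; rewrite /F /h !mxE !ord_adj_vertex /adj /= eqxx eq_sym.
  by case: eqP => _ /=; rewrite ?mulr1n ?mulr0n ?subrr ?expr0n ?subr0.
have -> : \sum_(t : 'I_k * 'I_k * 'I_q) a ^+ 2 *+ (th t.1 t.2 != th' t.1 t.2) =
    a ^+ 2 * (\sum_(t : 'I_k * 'I_k * 'I_q) (th t.1 t.2 != th' t.1 t.2))%N%:R.
  by rewrite natr_sum mulr_sumr; apply: eq_bigr => t _; rewrite mulr_natr.
rewrite ler_wpM2l ?sqr_ge0 // lerBlDr -natrD ler_nat.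
rewrite /agree pair_bigA /= -big_split /=.
have -> : (k * k * q)%N = #|{: 'I_k * 'I_k * 'I_q}| by rewrite !card_prod !card_ord.
by rewrite -sum1_card; apply: leq_sum => t _; case: eqP.
Qed.

Lemma sum_agree_graph_family th :
  \sum_(th' : param) q.+1%:R ^+ agree th th' <= (q`!%:R * expR (2 * q%:R)) ^+ (k * k) :> R.
Proof.
pose F c (t : {perm 'I_q}) : R := q.+1%:R ^+ (\sum_x (th c x == t x)).
have -> : \sum_(th' : param) q.+1%:R ^+ agree th th' = \prod_c \sum_t F c t.
  by rewrite bigA_distr_bigA; apply: eq_bigr => th' _; rewrite prodrXr.
have -> : (k * k)%N = #|{: 'I_k * 'I_k}| by rewrite card_prod !card_ord.
rewrite -prodr_const; apply: ler_prod => c _; rewrite sum_perm_agree andbT.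
by apply: sumr_ge0 => t _; rewrite exprn_ge0.
Qed.

(** [packing_card] is used with [y ^+ 2 = q.+1%:R]. The bound [Y] contains the size of the family as
    a factor; once it cancels, the counting condition is the last hypothesis. *)
Lemma minimax_graph (n s0 : nat) (tau0 eta : R) :
  0 <= a -> a * k%:R <= eta -> eta <= 2^-1 -> tau0^-1 <= 1 - eta -> 1 + eta <= tau0 ->
  (p * k <= s0)%N ->
  4 * expR (n%:R * (a ^+ 2 * (p * k)%:R) + 2 * (k * k * q)%:R)
    <= Num.sqrt q.+1%:R ^+ (k * k * q) ->
  ((a ^+ 2 * (k * k * q)%:R / 16)%:E <= minimax_risk p n s0 tau0)%E.
Proof.
move=> a0 ak eh lo hi pk bnd; set N := (k * k * q)%N.
have rA th : row_sum_le eta (graph_family th).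
  by move=> i; apply: le_trans (row_sum_graph_family th a0 i) ak.
pose y : R := Num.sqrt q.+1%:R.
have y2 : y ^+ 2 = q.+1%:R by rewrite sqr_sqrtr.
have y1 : 1 <= y by rewrite -sqrtr1 ler_wsqrtr // ler1n.
have y0 : 0 < y ^+ N by rewrite exprn_gt0 // (lt_le_trans _ y1).
pose Y : R := (q`!%:R * expR (2 * q%:R)) ^+ (k * k).
have Y0 : 0 <= Y by rewrite exprn_ge0 // mulr_ge0 // expR_ge0.
apply: le_trans (minimax_lower (n := n) (s0 := s0) (r := a ^+ 2 * N%:R / 8)
  (b := Y / y ^+ N) tr_graph_family rA eh lo hi _ frob2_graph_family_le _ _ _ _ _).
- by rewrite lee_fin; lra.
- by move=> th; apply: leq_trans (offdiag_nnz_graph_family th) pk.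
- by apply/card_gt0P; exists [ffun=> 1%g].
- by rewrite divr_ge0 // mulr_ge0 ?sqr_ge0.
- by rewrite divr_ge0 // ltW.
- apply: (packing_card (agr := agree) y1 Y0 frob2_graph_family_ge) => th.
  by rewrite y2; exact: sum_agree_graph_family.
have -> : #|{: param}| = (q`! ^ (k * k))%N.
  rewrite card_ffun card_prod !card_ord; congr (_ ^ _)%N.
  have := card_perm [set: 'I_q]; rewrite cardsT card_ord => <-.
  by apply: eq_card => s; rewrite !inE; apply/esym/fintype.subsetP => x _; rewrite inE.
have -> : Y = q`!%:R ^+ (k * k) * expR (2 * N%:R).
  rewrite /Y exprMn -expRM_natl; congr (_ * expR _); rewrite /N !natrM; ring.
rewrite natrX mulrA ler_pdivrMr // mulrCA ler_wpM2l ?exprn_ge0 //.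
by rewrite -mulrA -expRD.
Qed.

End bipartite_family.

(** * Asymptotics *)

Lemma divn_degree (p s : nat) : (0 < p)%N -> (3 * p < s)%N ->
  [/\ (p * (s %/ p) <= s)%N, (0 < s %/ p)%N & (s <= 2 * (s %/ p * p))%N].
Proof.
move=> p0 s3p; have lo : (s %/ p * p <= s)%N by exact: leq_divM.
have hi := ltn_ceil s p0; have k0 : (0 < s %/ p)%N by rewrite divn_gt0 //; lia.
by move: lo hi k0; set k := (s %/ p)%N => lo hi k0; split; nia.
Qed.

(** The quotient is the largest size for which [2 * k] blocks fit into [p] indices; rounding costs
    at most a factor 2. *)
Lemma divn_block (p k : nat) : (0 < k)%N -> (4 * k <= p)%N ->
  (2 * k * (p %/ (2 * k)) <= p)%N /\ (p <= 4 * k * (p %/ (2 * k)))%N.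
Proof.
move=> k0 k4p; have k20 : (0 < 2 * k)%N by lia.
have lo : (p %/ (2 * k) * (2 * k) <= p)%N by exact: leq_divM.
have hi := ltn_ceil p k20.
by move: lo hi; set q := (p %/ (2 * k))%N => lo hi; split; nia.
Qed.

Lemma block_count (p k q s : nat) : (0 < p)%N -> (0 < k)%N -> (p <= 4 * k * q)%N ->
  (s <= 2 * (k * p))%N ->
  [/\ (p * k <= 4 * (k * k * q))%N, (s <= 8 * (k * k * q))%N & (0 < k * k * q)%N].
Proof.
move=> p0 k0 pq sk.
have h : (p * k <= 4 * (k * k * q))%N by nia.
by split; [by []|lia|nia].
Qed.

Section sparse_bound.
Context {R : realType}.

(** The graph has degree [k ~ s0 / p] and blocks of size [q ~ p / k]. The cubic bound on [s0] keeps
    [q] at least of order [sqrt p], so that [ln q] is comparable to [ln p]; the bound with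
    logarithms keeps the row sums [a * k] below [eta]. *)
Lemma minimax_sparse (p n s0 : nat) (tau0 eta K c : R) :
  (0 < n)%N -> 1 <= K -> 0 < eta -> eta <= 2^-1 -> tau0^-1 <= 1 - eta -> 1 + eta <= tau0 ->
  0 < c -> c <= 64^-1 -> c * K <= eta ^+ 2 ->
  (3 * p < s0)%N -> s0%:R ^+ 2 <= K * p%:R ^+ 3 ->
  s0%:R ^+ 2 * ln p%:R ^+ 3 <= K * (p%:R ^+ 2 * n%:R) ->
  64 <= ln (p%:R : R) -> 2 * ln (16 * K) <= ln p%:R ->
  ((c / 128 * (s0%:R * ln p%:R / n%:R))%:E <= minimax_risk p n s0 tau0)%E.
Proof.
move=> n0 K1 eta0 eh lo hi c0 c64 cK s3p s2 s2ln lnp64 lnpK.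
have p0 : (0 < p)%N.
  (* Since [ln] is 0 at 0, the case [p = 0] contradicts [lnp64]. *)
  by case: p {s3p s2 s2ln lnpK} lnp64 => // ; rewrite ln0 //; lra.
have pR : 0 < p%:R :> R by rewrite ltr0n.
have nR : 0 < n%:R :> R by rewrite ltr0n.
set l := ln p%:R in s2ln lnp64 lnpK *.
pose k := (s0 %/ p)%N; pose q := (p %/ (2 * k))%N; pose N := (k * k * q)%N.
have [kp k0 kp2] := divn_degree p0 s3p; rewrite -/k in kp k0 kp2.
have kR : 1 <= k%:R :> R by rewrite ler1n.
have kpR : p%:R * k%:R <= s0%:R :> R by rewrite -natrM ler_nat.
have k2 : k%:R ^+ 2 <= K * p%:R.
  have : (p%:R * k%:R) ^+ 2 <= s0%:R ^+ 2 :> R by rewrite lerXn2r ?nnegrE ?mulr_ge0.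
  move=> /le_trans/(_ s2); rewrite exprMn => H.
  have : p%:R ^+ 2 * k%:R ^+ 2 <= p%:R ^+ 2 * (K * p%:R) by apply: le_trans H _; rewrite exprS; lra.
  by rewrite ler_pM2l // exprn_gt0.
have pK : (16 * K) ^+ 2 <= p%:R.
  have K16 : 0 < 16 * K by lra.
  by rewrite -ler_ln ?posrE ?exprn_gt0 // lnXn // -[_ *+ 2]mulr_natl.
have k4p : (4 * k <= p)%N.
  rewrite -(ler_nat R) natrM -(@ler_pXn2r _ 2) ?nnegrE ?mulr_ge0 //.
  have : (16 * K) * p%:R <= p%:R * p%:R by rewrite ler_pM2r //; nra.
  rewrite exprMn [p%:R ^+ 2]expr2; lra.
have [q_lo q_hi] := divn_block k0 k4p; rewrite -/q in q_lo q_hi.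
have [N4 N8 N1] := block_count p0 k0 q_hi kp2; rewrite -/N in N4 N8 N1.
(* From [p <= 4 k q] and [k ^ 2 <= K p] one gets [p <= 16 K q ^ 2]; squaring and using [pK] cancels
   one factor [p]. *)
have q4 : p%:R <= q.+1%:R ^+ 4 :> R.
  have h1 : p%:R <= 4 * k%:R * q%:R :> R by rewrite -!natrM ler_nat.
  have h2 : p%:R <= 16 * K * q%:R ^+ 2.
    rewrite -(ler_pM2r pR).
    have : p%:R ^+ 2 <= (4 * k%:R * q%:R) ^+ 2 :> R by rewrite lerXn2r ?nnegrE ?mulr_ge0.
    have := ler_wpM2r (sqr_ge0 (q%:R : R)) k2.
    lra.
  have h3 : p%:R ^+ 2 <= p%:R * q%:R ^+ 4 :> R.
    apply: (@le_trans _ _ ((16 * K * q%:R ^+ 2) ^+ 2)).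
      by rewrite lerXn2r ?nnegrE ?mulr_ge0 ?sqr_ge0 //; lra.
    by rewrite exprMn -exprM ler_wpM2r ?exprn_ge0.
  move: h3; rewrite expr2 ler_pM2l // => /le_trans; apply.
  by rewrite lerXn2r ?nnegrE // ler_nat.
have lnq : l / 4 <= ln (q.+1%:R : R).
  have : l <= ln (q.+1%:R ^+ 4 : R) by rewrite ler_ln ?posrE ?exprn_gt0.
  rewrite lnXn // -mulr_natl; lra.
pose a := Num.sqrt (c * l / n%:R).
have l0 : 0 < l by lra.
have a2 : a ^+ 2 = c * l / n%:R by rewrite sqr_sqrtr // divr_ge0 ?mulr_ge0 ?ltW.
have ak : a * k%:R <= eta.
  rewrite -(@ler_pXn2r _ 2) ?nnegrE ?mulr_ge0 ?sqrtr_ge0 ?(ltW eta0) //.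
  rewrite exprMn a2 mulrAC ler_pdivrMr //.
  have kl : k%:R ^+ 2 * l ^+ 3 <= K * n%:R.
    rewrite -(ler_pM2l (exprn_gt0 2 pR)).
    apply: (@le_trans _ _ (s0%:R ^+ 2 * l ^+ 3)); last by lra.
    rewrite mulrA ler_wpM2r ?exprn_ge0 ?(ltW l0) // -exprMn.
    by rewrite lerXn2r ?nnegrE ?mulr_ge0.
  have l3 : l <= l ^+ 3.
    by rewrite -[X in X <= _]expr1 ler_weXn2l //; lra.
  have k2l : k%:R ^+ 2 * l <= K * n%:R.
    by apply: le_trans kl; rewrite ler_wpM2l ?sqr_ge0.
  have := ler_wpM2l (ltW c0) k2l; have := ler_wpM2r (ltW nR) cK; lra.
have vle : (#|{: bool * ('I_k * 'I_q)}| <= p)%N.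
  by rewrite !card_prod card_bool !card_ord mulnA.
have NR : 1 <= N%:R :> R by rewrite ler1n.
have N4R : (p * k)%:R <= 4 * N%:R :> R by rewrite -natrM ler_nat.
apply: le_trans (minimax_graph (n := n) vle (sqrtr_ge0 _) ak eh lo hi kp _).
  rewrite lee_fin a2 -/N.
  have -> : c / 128 * (s0%:R * l / n%:R) = (c * l / n%:R) * (s0%:R / 128) by ring.
  have -> : c * l / n%:R * N%:R / 16 = (c * l / n%:R) * (N%:R / 16) by ring.
  rewrite ler_wpM2l ?divr_ge0 ?mulr_ge0 ?(ltW c0) ?(ltW l0) //.
  have : s0%:R <= 8 * N%:R :> R by rewrite -natrM ler_nat.
  lra.
rewrite -/N; have q0 : 0 < Num.sqrt q.+1%:R :> R by rewrite sqrtr_gt0.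
have sq : expR (l / 8) <= Num.sqrt q.+1%:R.
  rewrite -ler_ln ?posrE ?expR_gt0 // expRK.
  have : ln (q.+1%:R : R) = 2 * ln (Num.sqrt q.+1%:R).
    by rewrite -[X in ln X = _](@sqr_sqrtr _ q.+1%:R) // lnXn // mulr_natl.
  lra.
(* Of the exponent [N l / 8], the bound [c <= 1/64] lets the chi-square use [N l / 16]; the rest
   covers [2 + 2 N] because [l >= 64] and [N >= 1]. *)
apply: (@le_trans _ _ (expR (l / 8) ^+ N)); last first.
  by rewrite lerXn2r ?nnegrE ?expR_ge0 ?(ltW q0).
have e2 : 4 <= expR (2 : R).
  rewrite -[2]mulr1 expRM_natl; have := expR_ge1Dx (1 : R); rewrite expr2; nra.
rewrite -expRM_natl; apply: (@le_trans _ _ (expR 2 * expR (N%:R * l / 16 + 2 * N%:R))).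
  apply: ler_pM; [by rewrite ler0n|exact: expR_ge0|exact: e2|].
  rewrite ler_expR lerD2r a2.
  have -> : n%:R * (c * l / n%:R * (p * k)%:R) = c * l * (p * k)%:R.
    by field; rewrite gt_eqF.
  have cl0 : 0 <= c * l by rewrite mulr_ge0 ?ltW.
  apply: le_trans (ler_wpM2l cl0 N4R) _.
  have := ler_wpM2r (mulr_ge0 (ltW l0) (ler0n R N)) c64; lra.
rewrite -expRD ler_expR.
have := ler_wpM2l (ler0n R N) lnp64; lra.
Qed.

End sparse_bound.

Lemma tau_margin (R : realType) (tau0 : R) : 1 < tau0 ->
  exists eta : R, [/\ 0 < eta, eta <= 2^-1, tau0^-1 <= 1 - eta & 1 + eta <= tau0].
Proof.
move=> t1; have t0 : 0 < tau0 by lra.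
have ti : tau0^-1 < 1 by rewrite invf_lt1.
have tt : tau0 * tau0^-1 = 1 by rewrite mulfV // gt_eqF.
(* The upper margin follows from the lower one because [tau0 + tau0^-1 >= 2]. *)
exists (Num.min 2^-1 (1 - tau0^-1)); split.
- by rewrite lt_min; apply/andP; split; lra.
- by rewrite ge_min lexx.
- have : Num.min 2^-1 (1 - tau0^-1) <= 1 - tau0^-1 by rewrite ge_min lexx orbT.
  lra.
- have : Num.min 2^-1 (1 - tau0^-1) <= 1 - tau0^-1 by rewrite ge_min lexx orbT.
  nra.
Qed.

Theorem theorem2 (R : realType) (p s0 : nat -> nat) (tau0 : R) :
  1 < tau0 ->
  (forall n, (0 < p n)%N) ->
  (forall n, (0 < s0 n)%N) ->
  (exists K : R, forall n, (0 < n)%N ->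
     (s0 n)%:R ^+ 2 * (ln (p n)%:R) ^+ 3 <= K * ((p n)%:R ^+ 2 * n%:R)) ->
  (exists eps : R, 0 < eps /\ exists K : R, forall n,
     (s0 n)%:R ^+ 2 <= K * powR (p n)%:R (3 - eps)) ->
  exists C : R, 0 < C /\
    \forall n \near \oo,
      ((C * ((s0 n)%:R * ln (p n)%:R / n%:R * (3 * p n < s0 n)%N%:R
             + (p n)%:R / n%:R))%:E
       <= minimax_risk (p n) n (s0 n) tau0)%E.
Proof.
move=> t1 p0 _ [K1 HK1] [eps [eps0 [K2 HK2]]].
have [eta [eta0 eh lo hi]] := tau_margin t1.
pose K := Num.max 1 (Num.max K1 K2).
have K_1 : 1 <= K by rewrite le_max lexx.
have K_K1 : K1 <= K by rewrite !le_max lexx orbT.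
have K_K2 : K2 <= K by rewrite !le_max lexx !orbT.
pose c := Num.min 64^-1 (eta ^+ 2 / K).
have c0 : 0 < c.
  by rewrite lt_min invr_gt0 ltr0n divr_gt0 ?exprn_gt0 //; lra.
have c64 : c <= 64^-1 by rewrite ge_min lexx.
have cK : c * K <= eta ^+ 2.
  by rewrite -ler_pdivlMr ?(lt_le_trans _ K_1) // ge_min lexx orbT.
(* [L] is the threshold on [ln p] above which [minimax_sparse] applies. *)
pose L : R := Num.max 64 (2 * ln (16 * K)).
have L64 : 64 <= L by rewrite le_max lexx.
have LK : 2 * ln (16 * K) <= L by rewrite le_max lexx orbT.
have pR n : 1 <= (p n)%:R :> R by rewrite ler1n.
have s2 n : (s0 n)%:R ^+ 2 <= K * (p n)%:R ^+ 3 :> R.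
  apply: le_trans (HK2 n) _.
  apply: (@le_trans _ _ (K * powR (p n)%:R (3 - eps))); first by rewrite ler_wpM2r ?powR_ge0.
  rewrite ler_wpM2l ?(le_trans ler01) // -powR_mulrn ?(le_trans ler01) //.
  by apply: ler_powR => //; lra.
(* If [ln p] is below [L], then [p ^ 3 <= e ^ L p ^ 2], so [s0] is at most a constant times [p] and
   the sparse term is at most [D] times [p / n]. *)
pose D : R := L * (1 + K * expR L).
have D0 : 0 <= D.
  by rewrite mulr_ge0 ?addr_ge0 ?mulr_ge0 ?expR_ge0 //; lra.
pose c1 : R := (64 * 16 ^+ 4)^-1; pose c2 := c / 128.
have c1_gt0 : 0 < c1 by rewrite invr_gt0 mulr_gt0 // exprn_gt0.
have c2_gt0 : 0 < c2 by rewrite divr_gt0.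
exists (Num.min (c2 / 2) (c1 / (2 * (1 + D)))).
set C := Num.min _ _.
have C_c2 : C <= c2 / 2 by rewrite ge_min lexx.
have C_D : C * (2 * (1 + D)) <= c1.
  by rewrite -ler_pdivlMr ?ge_min ?lexx ?orbT // mulr_gt0 // ltr_wpDr.
have C0 : 0 < C by rewrite lt_min !divr_gt0 // mulr_gt0 // ltr_wpDr.
split=> //.
near=> n.
have n0 : (0 < n)%N by near: n; exists 1%N.
have nR : 0 < n%:R :> R by rewrite ltr0n.
have neta : 1 <= 4 * eta ^+ 2 * n%:R.
  have e20 : 0 < 4 * eta ^+ 2 by rewrite mulr_gt0 // exprn_gt0.
  rewrite mulrC -ler_pdivrMr // div1r; near: n; exact: nbhs_infty_ger.
have Hdiag := minimax_diag (s0 n) (p0 n) n0 (ltW eta0) eh lo hi neta.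
set P : R := (p n)%:R / n%:R in Hdiag *.
rewrite [P / _]mulrC -/c1 in Hdiag.
have P0 : 0 <= P by rewrite divr_ge0.
have C2 : C * 2 <= c1.
  apply: le_trans C_D; rewrite ler_pM2l // -[X in X <= _]mulr1 ler_pM2l //; lra.
(* When the sparse term is dominated by [p / n], the diagonal bound alone suffices. This covers both
   [s0 <= 3 p] and bounded [p]. *)
have small (T : R) : T <= D * P -> ((C * (T + P))%:E <= minimax_risk (p n) n (s0 n) tau0)%E.
  move=> TD; apply: le_trans Hdiag; rewrite lee_fin.
  have h1 : C * (T + P) <= C * ((1 + D) * P).
    by rewrite ler_pM2l // mulrDl mul1r [P + _]addrC lerD2r.
  have h2 : C * ((1 + D) * P) <= C * (2 * (1 + D)) * P.
    rewrite mulrA ler_wpM2r // ler_pM2l //; lra.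
  by apply: le_trans h1 (le_trans h2 _); rewrite ler_wpM2r.
have [s3p|s3p] := boolP (3 * p n < s0 n)%N; last first.
  by apply: small; rewrite mulr0 mulr_ge0.
rewrite mulr1; have [lnp|lnp] := leP L (ln (p n)%:R).
  have s2ln : (s0 n)%:R ^+ 2 * ln (p n)%:R ^+ 3 <= K * ((p n)%:R ^+ 2 * n%:R) :> R.
    by apply: le_trans (HK1 n n0) _; rewrite ler_wpM2r // mulr_ge0 ?sqr_ge0.
  have := minimax_sparse n0 K_1 eta0 eh lo hi c0 c64 cK s3p (s2 n) s2ln
    (le_trans L64 lnp) (le_trans LK lnp).
  rewrite -/c2; set T : R := (s0 n)%:R * _ / _ => Hsp.
  have T0 : 0 <= T by rewrite divr_ge0 // mulr_ge0 // ln_ge0.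
  have h1 : C * T <= c2 / 2 * T by rewrite ler_wpM2r.
  have h2 : C * P * 2 <= c1 * P by rewrite mulrAC ler_wpM2r.
  (* The larger of the two lower bounds is at least their average, hence the halves in the
     constant. *)
  have [le12|lt21] := leP (c2 * T) (c1 * P).
    by apply: le_trans Hdiag; rewrite lee_fin; lra.
  by apply: le_trans Hsp; rewrite lee_fin; lra.
apply: small; rewrite /P mulrA ler_wpM2r ?invr_ge0 // /D.
have pn0 : 0 < (p n)%:R :> R := lt_le_trans ltr01 (pR n).
have pL : (p n)%:R <= expR L.
  by rewrite -[X in X <= _]lnK ?posrE // ler_expR ltW.
have KL0 : 0 <= K * expR L by rewrite mulr_ge0 ?expR_ge0 // (le_trans ler01).
have sp : (s0 n)%:R <= (1 + K * expR L) * (p n)%:R :> R.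
  rewrite -(@ler_pXn2r _ 2) ?nnegrE ?mulr_ge0 ?addr_ge0 // exprMn.
  apply: le_trans (s2 n) _.
  have h1 : K * (p n)%:R ^+ 3 <= K * expR L * (p n)%:R ^+ 2.
    rewrite exprS mulrA ler_wpM2r ?sqr_ge0 // ler_wpM2l // (le_trans ler01) //.
  apply: le_trans h1 _; rewrite ler_wpM2r ?sqr_ge0 //; nra.
apply: le_trans (ler_pM _ _ sp (ltW lnp)) _ => //; first exact: ln_ge0.
by rewrite le_eqVlt; apply/orP; left; apply/eqP; ring.
Unshelve. all: by end_near.
Qed.
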